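(* For every smooth Minkowski space $X$ of dimension $d\ge 2$, $$3\le s(X)\le v(X)\le d+1.$$ Moreover the outer inequalities are sharp in general: for every $d\ge 2$ there is a smooth $d$-dimensional Minkowski space $X$ with $s(X)=3$, and for every $d\ge 2$ there is a smooth $d$-dimensional Minkowski space $X$ with $v(X)=d+1$.
   Context: A Minkowski space is a finite-dimensional real Banach space $X$ with norm $\|\cdot\|$. $X$ is smooth if $\lim_{t\to 0}\frac{\|x+th\|-\|x\|}{t}$ exists for all $x,h\in X$ with $x\ne 0$. For a finite set $S\subseteq X$, a Steiner Minimal Tree (SMT) of $S$ is a finite tree $T$ whose vertex set $V(T)$ satisfies $S\subseteq V(T)\subseteq X$ and whose total length $\sum_{\{x,y\}\in E(T)}\|x-y\|$ is minimal among all finite trees with vertex set $V$ satisfying $S\subseteq V\subseteq X$. The elements of $S$ are called the vertices of the SMT, and the elements of $V(T)\setminus S$ its Steiner points. $v(X)$ denotes the largest degree (in $T$) of a vertex, i.e. an element of $S$, over all SMTs $T$ of finite sets $S$ in $X$; $s(X)$ denotes the largest degree of a Steiner point over all SMTs of finite sets in $X$. *)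

(* Defs.v *)
From HB Require Import structures.
From mathcomp Require Import all_boot all_order all_algebra finmap.
From mathcomp Require Import all_classical all_reals all_analysis.

Set Implicit Arguments.
Unset Strict Implicit.
Unset Printing Implicit Defensive.

Import Order.TTheory GRing.Theory Num.Theory.
Import numFieldNormedType.Exports.

Local Open Scope classical_set_scope.
Local Open Scope ring_scope.

(* A Minkowski space is a complete normed module over the reals together with
   [has_dim d X] for some d; [Vector.axiom] lives in Type, hence [inhabited]. *)
Definition has_dim (R : realType) (d : nat) (X : completeNormedModType R) : Prop :=
  inhabited (Vector.axiom d X).

Definition smooth (R : realType) (X : completeNormedModType R) : Prop :=
  forall x h : X, x != 0 -> derivable (fun y : X => `|y| : R^o) x h.

Record graph_in (X : choiceType) := GraphIn {
  gvert : {fset X};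
  gadj : rel gvert;
  gadj_sym : symmetric gadj;
  gadj_irr : irreflexive gadj
}.

Definition gconnected (X : choiceType) (T : graph_in X) : Prop :=
  (0 < #|{: gvert T}|)%N /\ forall x y : gvert T, connect (@gadj X T) x y.

(* An edge traversed back and forth is a [ucycle] of size 2, so only sizes at
   least 3 count as cycles. *)
Definition gacyclic (X : choiceType) (T : graph_in X) : Prop :=
  forall c : seq (gvert T), ucycle (@gadj X T) c -> (size c <= 2)%N.

Definition is_tree (X : choiceType) (T : graph_in X) : Prop :=
  gconnected T /\ gacyclic T.

Definition degree (X : choiceType) (T : graph_in X) (x : gvert T) : nat :=
  #|[pred y | gadj x y]|.

(* The factor 1/2 is there because the sum ranges over ordered pairs. *)
Definition total_length (R : realType) (X : completeNormedModType R)
    (T : graph_in X) : R :=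
  2^-1 * \sum_(x : gvert T) \sum_(y : gvert T | gadj x y) `|val x - val y|.

Definition tree_containing (X : choiceType) (S : {fset X}) (T : graph_in X) : Prop :=
  is_tree T /\ (S `<=` gvert T)%fset.

Definition steiner_minimal_tree (R : realType) (X : completeNormedModType R)
    (S : {fset X}) (T : graph_in X) : Prop :=
  tree_containing S T /\
  forall T' : graph_in X, tree_containing S T' ->
    total_length T <= total_length T'.

Definition vertex_degrees (R : realType) (X : completeNormedModType R) : set nat :=
  [set n | exists (S : {fset X}) (T : graph_in X) (x : gvert T),
    [/\ steiner_minimal_tree S T, val x \in S & degree x = n]].

Definition steiner_degrees (R : realType) (X : completeNormedModType R) : set nat :=
  [set n | exists (S : {fset X}) (T : graph_in X) (x : gvert T),
    [/\ steiner_minimal_tree S T, val x \notin S & degree x = n]].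

Definition is_largest (A : set nat) (n : nat) : Prop :=
  A n /\ forall m, A m -> (m <= n)%N.

(* [is_v X n] is "v(X) = n" and [is_s X n] is "s(X) = n"; being relations, they
   also assert that the largest degree exists. *)
Definition is_v (R : realType) (X : completeNormedModType R) (n : nat) : Prop :=
  is_largest (vertex_degrees X) n.

Definition is_s (R : realType) (X : completeNormedModType R) (n : nat) : Prop :=
  is_largest (steiner_degrees X) n.

(* Main.v *)
Require Import Defs.
From HB Require Import structures.
From mathcomp Require Import all_boot all_order all_algebra perm finmap.
From mathcomp Require Import all_classical all_reals all_analysis.
From mathcomp Require Import ring lra zify.

(* Let u_i be the edge vectors at a node of a minimal tree and phi_i the derivative of
   the norm at u_i. Pulling any subset I of the edges off the node shows that the sum of
   phi_i over I has dual norm at most 1. Hence phi_j(u_i) <= 0 for j <> i, strictly since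
   phi_i is the only norming functional of u_i, and (phi_j(u_i)) is a weakly diagonally
   dominant matrix whose kernel contains only constants: its rank, at most d, is at least
   the degree minus 1. Conversely, unit vectors a_i normed by functionals phi_i whose
   subset sums have dual norm at most 1 give a minimal star centred at 0: in any tree
   through 0 and the a_i, each edge is at least as long as the value on it of the sum of
   the phi_i of the terminals beyond it. If the phi_i add up to 0, the tree need not pass
   through 0, so the centre is a Steiner point. Three such functionals exist in every dual
   plane. In Euclidean space the subset condition forces degree at most 3. For degree
   d + 1, take the coordinates on the hyperplane of sum zero in dimension d + 1 and a
   smooth permutation-invariant norm for which the sums of 2 <= k <= d - 1 coordinates are
   dominated by single coordinates. *)

Set Implicit Arguments.
Unset Strict Implicit.
Unset Printing Implicit Defensive.

Import Order.TTheory GRing.Theory Num.Theory.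
Import numFieldNormedType.Exports.

Local Open Scope ring_scope.

(** * Networks and spanning trees *)

Section ParentGraph.
Context (W : finType) (r : W) (par : W -> W) (rk : W -> nat).
Hypothesis rk_par : forall x, x != r -> (rk (par x) < rk x)%N.

(** A rooted tree is encoded by a parent map together with a rank that drops strictly towards the
    root. Connectedness and acyclicity both follow from the rank; [par r] is a dummy value. *)
Definition pedge : rel W :=
  fun x y => (x != r) && (y == par x) || (y != r) && (x == par y).

Lemma pedge_sym : symmetric pedge.
Proof. by move=> x y; rewrite /pedge orbC. Qed.

Lemma pedge_irr : irreflexive pedge.
Proof.
move=> x; rewrite /pedge orbb; apply/negP => /andP[/rk_par rkx /eqP xE].
by rewrite -xE ltnn in rkx.
Qed.

Lemma pedge_connect_root x : connect pedge x r.
Proof.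
have [n] := ubnP (rk x); elim: n x => // n IHn x; rewrite ltnS => rkx.
have [->//|xr] := eqVneq x r.
apply: connect_trans (IHn (par x) _); last exact: leq_trans (rk_par xr) rkx.
by apply: connect1; rewrite /pedge xr eqxx.
Qed.

Lemma pedge_connect x y : connect pedge x y.
Proof.
apply: connect_trans (pedge_connect_root x) _.
by rewrite (sym_connect_sym pedge_sym) pedge_connect_root.
Qed.

(* Both neighbours on a cycle of a vertex of maximal rank are its parent. *)
Lemma pedge_acyclic (c : seq W) : ucycle pedge c -> (size c <= 2)%N.
Proof.
case: c => // x0 c0; set c := x0 :: c0 => /andP[cyc unc].
have [x xc xmax] : exists2 x, x \in c & forall y, y \in c -> (rk y <= rk x)%N.
  case: (@arg_maxnP _ x0 (mem c) rk) => [|x xc xmax]; first exact: mem_head.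
  by exists x.
have edge_par y : y \in c -> pedge x y -> y = par x.
  move=> yc /orP[/andP[_ /eqP//]|/andP[yr /eqP xE]].
  by have := rk_par yr; rewrite -xE ltnNge xmax.
have [i c' cE] := rot_to xc.
have szE : size c = (size c').+1 by rewrite -(size_rot i) cE.
have : cycle pedge (x :: c') by rewrite -cE rot_cycle.
have : uniq (x :: c') by rewrite -cE rot_uniq.
have {cE}c'c y : y \in c' -> y \in c.
  by move=> yc'; rewrite -(mem_rot i) cE inE yc' orbT.
rewrite szE; case: c' c'c {szE} => [//|y [//|z c']] c'c.
rewrite [uniq _]/= => /and3P[_ yzc' _].
rewrite [cycle _ _]/= rcons_path => /and4P[xy _ _]; rewrite pedge_sym => lastx.
have yE : y = par x by apply: edge_par => //; apply: c'c; rewrite mem_head.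
have lE : last z c' = par x.
  by apply: edge_par => //; apply: c'c; rewrite inE mem_last orbT.
by move: yzc'; rewrite yE -lE mem_last.
Qed.

End ParentGraph.

Section Networks.
Context (R : realType) (X : completeNormedModType R).
Context (W : finType) (e : rel W) (p : W -> X).
Hypothesis e_sym : symmetric e.
Hypothesis e_conn : forall x y, connect e x y.

(** Nodes live in an abstract finite type and [p] need not be injective, so a competitor to a tree
    can be built without checking that its new nodes avoid the old points. *)
Definition net_length : R :=
  2^-1 * \sum_(x : W) \sum_(y : W | e x y) `|p x - p y|.

(** Breadth-first search: the rank is the length of a shortest path from [r], and the parent is the
    last node but one on such a path. *)
Lemma exists_parent (r : W) : exists (par : W -> W) (rk : W -> nat),
  forall x, x != r -> e x (par x) /\ (rk (par x) < rk x)%N.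
Proof.
pose P x n := [exists q : n.-tuple W, path e r q && (last r q == x)].
have exP x : exists n, P x n.
  have /connectP[q q_path q_last] := e_conn r x.
  exists (size q); apply/existsP; exists (in_tuple q).
  by apply/andP; split=> //=; apply/eqP/esym.
pose rk x := ex_minn (exP x).
have step x : exists y, x != r -> e x y /\ (rk y < rk x)%N.
  have [->|xr] := eqVneq x r; first by exists r.
  rewrite {2}/rk; case: ex_minnP => -[|n] /existsP[/= q /andP[qp ql]] _.
    by case/negP: xr; rewrite -(eqP ql) (tuple0 q).
  case/lastP: {q}(val q) (size_tuple q) qp ql => [//|q y].
  rewrite size_rcons rcons_path last_rcons => -[szq] /andP[qp qy] /eqP yx.
  exists (last r q) => _; rewrite e_sym -yx; split=> //; rewrite ltnS /rk.
  case: ex_minnP => m _; apply; apply/existsP.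
  by exists (tcast szq (in_tuple q)); rewrite /= val_tcast qp eqxx.
have [par parP] := choice step.
by exists par, rk.
Qed.

Context (r : W) (par : W -> W) (rk : W -> nat).
Hypothesis parP : forall x, x != r -> e x (par x) /\ (rk (par x) < rk x)%N.

(** The double sum contains the pairs [(x, par x)] and their reverses. No pair is of both kinds,
    since the rank would have to drop in both directions. *)
Lemma parent_length_le : \sum_(x | x != r) `|p x - p (par x)| <= net_length.
Proof.
rewrite /net_length mulrC ler_pdivlMr// mulr_natr mulr2n.
rewrite pair_big_dep /=.
pose up x := (x, par x); pose dn x := (par x, x).
have F_ge0 (xy : W * W) : 0 <= `|p xy.1 - p xy.2| by [].
rewrite (bigID (fun xy : W * W => (xy.1 != r) && (xy.2 == par xy.1))) /=.
apply: lerD.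
  rewrite (reindex_onto up fst) /=; last first.
    by move=> [x y] /= /andP[_ /andP[_ /eqP->]].
  rewrite le_eqVlt; apply/orP; left; apply/eqP; apply: eq_bigl => x /=.
  by rewrite !eqxx !andbT; have [->|/parP[-> _]] := eqVneq x r; rewrite ?andbF.
apply: (@le_trans _ _
  (\sum_(xy : W * W | (xy.2 != r) && (xy.1 == par xy.2)) `|p xy.1 - p xy.2|)).
  rewrite (reindex_onto dn snd) /=; last first.
    by move=> [x y] /= /andP[_ /eqP->].
  rewrite le_eqVlt; apply/orP; left; apply/eqP; apply: eq_big => x /=.
    by rewrite !eqxx !andbT.
  by move=> _; rewrite distrC.
rewrite big_mkcond [leRHS]big_mkcond /=; apply: ler_sum => -[x y] _ /=.
case: ifP => [/andP[yr /eqP xE]|_]; last by case: ifP.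
have [eyx rk_lt] := parP yr; rewrite xE e_sym eyx /=.
case: ifP => // /negbT; rewrite negbK => /andP[xr /eqP yE].
have [_] := parP xr; rewrite -yE => /(ltn_trans rk_lt).
by rewrite ltnn.
Qed.

(** [A] is the path from [x] up to the root, root excluded, along which the increments of [g]
    telescope. The bound on ranks serves the induction: it keeps [x] out of the path of its
    parent. *)
Lemma ancestors x : exists A : {set W},
  [/\ r \notin A, forall w, w \in A -> (rk w <= rk x)%N &
    forall g : W -> R, g x - g r = \sum_(w in A) (g w - g (par w))].
Proof.
have [n] := ubnP (rk x); elim: n x => // n IHn x; rewrite ltnS => rkx.
have [->|xr] := eqVneq x r.
  exists finset.set0; split=> [|w|g]; rewrite ?inE//.
  by rewrite big_set0 subrr.
have [_ rk_lt] := parP xr.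
have [A [rA rkA sumA]] := IHn (par x) (leq_trans rk_lt rkx).
have xA : x \notin A by apply/negP => /rkA; rewrite leqNgt rk_lt.
exists (x |: A); split=> [|w|g].
- by rewrite !inE negb_or eq_sym xr.
- by rewrite !inE => /orP[/eqP->//|/rkA /leq_trans->//]; rewrite ltnW.
- by rewrite big_setU1//= -sumA addrA subrK.
Qed.

End Networks.

(* Every edge of a spanning tree rooted at [r] carries the sum of the [phi i] over
   the terminals [f i] beyond it. *)
Lemma calibration (R : realType) (X : completeNormedModType R) (W : finType)
    (e : rel W) (p : W -> X) (n : nat) (phi : 'I_n -> X -> R) (r : W)
    (f : 'I_n -> W) :
  symmetric e -> (forall x y, connect e x y) ->
  (forall i x y, phi i (x - y) = phi i x - phi i y) ->
  (forall (I : {set 'I_n}) v, \sum_(i in I) phi i v <= `|v|) ->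
  \sum_i phi i (p (f i)) - \sum_i phi i (p r) <= net_length e p.
Proof.
move=> e_sym e_conn phiB phi_le.
have [par [rk parP]] := exists_parent e_sym e_conn r.
apply: le_trans (parent_length_le p e_sym parP).
have [A AP] := choice (@ancestors R _ _ _ _ _ parP).
have -> : \sum_i phi i (p (f i)) - \sum_i phi i (p r) =
    \sum_i \sum_(w in A (f i)) phi i (p w - p (par w)).
  rewrite -sumrB; apply: eq_bigr => i _.
  have [_ _ /(_ (fun w => phi i (p w)))->] := AP (f i).
  by apply: eq_bigr => w _; rewrite phiB.
rewrite (exchange_big_dep (fun w => w != r)) /=; last first.
  by move=> i w _; apply: contraL => /eqP->; have [] := AP (f i).
apply: ler_sum => w _.
apply: le_trans (phi_le [set i | w \in A (f i)] _).
by rewrite le_eqVlt; apply/orP; left; apply/eqP; apply: eq_bigl => i; rewrite inE.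
Qed.

Section ParentTree.
Context (R : realType) (X : completeNormedModType R) (V : {fset X}).
Context (r : V) (par : V -> V) (rk : V -> nat).
Hypothesis rk_par : forall x, x != r -> (rk (par x) < rk x)%N.

Definition parent_tree : graph_in X :=
  GraphIn (pedge_sym r par) (pedge_irr rk_par).

Lemma parent_tree_is_tree : is_tree parent_tree.
Proof.
split; last by move=> c; exact: (pedge_acyclic rk_par).
split; last first.
  by move=> x y; apply (pedge_connect rk_par).
by apply/card_gt0P; exists (r : gvert parent_tree); rewrite inE.
Qed.

Lemma parent_tree_length :
  total_length parent_tree <= \sum_(x | x != r) `|val x - val (par x)|.
Proof.
rewrite /total_length mulrC ler_pdivrMr// mulr_natr mulr2n.
rewrite pair_big_dep /=.
pose F (xy : V * V) := `|val xy.1 - val xy.2|.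
have F_ge0 xy : 0 <= F xy by rewrite normr_ge0.
have -> : \sum_(x | x != r) `|val x - val (par x)| =
    \sum_(xy : V * V | (xy.1 != r) && (xy.2 == par xy.1)) F xy.
  rewrite (reindex_onto (fun x => (x, par x)) fst) /=; last first.
    by move=> [x y] /= /andP[_ /eqP->].
  by apply: eq_big => x /=; rewrite ?eqxx ?andbT.
have {2}-> : \sum_(xy : V * V | (xy.1 != r) && (xy.2 == par xy.1)) F xy =
    \sum_(xy : V * V | (xy.2 != r) && (xy.1 == par xy.2)) F xy.
  rewrite (reindex_onto (fun x : V * V => (x.2, x.1)) (fun x => (x.2, x.1))) /=; last first.
    by move=> [x y].
  by apply: eq_big => [[x y]|[x y] _] /=; rewrite ?eqxx ?andbT// /F /= distrC.
rewrite big_mkcond [X in _ <= X + _]big_mkcond [X in _ <= _ + X]big_mkcond.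
rewrite -big_split /=; apply: ler_sum => xy _.
rewrite /pedge; case: (_ && _) => /=; case: (_ && _) => //=; rewrite ?addr0 ?add0r//.
by rewrite lerDl.
Qed.

End ParentTree.

(* A network may have several nodes at the same point: identify them, then keep
   a spanning tree. *)
Lemma network_tree (R : realType) (X : completeNormedModType R) (W : finType)
    (e : rel W) (p : W -> X) (w0 : W) (S : {fset X}) :
  symmetric e -> (forall x y, connect e x y) ->
  (forall x, x \in S -> exists w, p w = x) ->
  exists2 T : graph_in X, tree_containing S T & total_length T <= net_length e p.
Proof.
move=> e_sym e_conn Sp.
pose V : {fset X} := [fset p w | w in W]%fset.
have pV w : p w \in V by apply/imfsetP; exists w.
pose q w : V := [` pV w]%fset.
have qE w : val (q w) = p w by [].
have q_surj (v : V) : exists w, q w = v.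
  have /imfsetP[w _ vE] := valP v.
  by exists w; apply: val_inj; rewrite qE.
pose e' : rel V := fun u v => [exists x, exists y, [&& e x y, q x == u & q y == v]].
have e'P u v : reflect (exists x y, [/\ e x y, q x = u & q y = v]) (e' u v).
  apply: (iffP existsP) => [[x /existsP[y /and3P[exy /eqP<- /eqP<-]]]|].
    by exists x, y.
  by move=> [x [y [exy <- <-]]]; exists x; apply/existsP; exists y; rewrite exy !eqxx.
have e'_sym : symmetric e'.
  by move=> u v; apply/e'P/e'P => -[x [y [exy <- <-]]]; exists y, x; rewrite e_sym.
have e'_conn u v : connect e' u v.
  have [x <-] := q_surj u; have [y <-] := q_surj v.
  have /connectP[s] := e_conn x y.
  elim: s x => [x _ ->//|z s IHs x /= /andP[exz zs] yE].
  apply: connect_trans (IHs z zs yE).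
  by apply: connect1; apply/e'P; exists x, z.
have [par [rk parP]] := exists_parent e'_sym e'_conn (q w0).
have rk_par x : x != q w0 -> (rk (par x) < rk x)%N by move=> /parP[].
exists (parent_tree rk_par).
  split; first exact: parent_tree_is_tree.
  by apply/fsubsetP => x /Sp[w <-]; exact: pV.
apply: le_trans (parent_tree_length rk_par) _.
apply: le_trans (parent_length_le val e'_sym parP) _.
rewrite /net_length ler_pM2l ?invr_gt0// !pair_big_dep /=.
pose qq (xy : W * W) := (q xy.1, q xy.2).
rewrite [leRHS](partition_big qq (fun uv => e' uv.1 uv.2)) /=; last first.
  by move=> [x y] /= exy; apply/e'P; exists x, y.
apply: ler_sum => -[u v] /= /e'P[x [y [exy xu yv]]].
rewrite (bigD1 (x, y)) /=; last by rewrite exy /qq /= xu yv eqxx.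
by rewrite -!qE xu yv lerDl sumr_ge0.
Qed.

(** * Calibrated stars *)

Section Scalar.
Context (R : realType) (X : lmodType R) (f : X -> R).
Hypothesis f_lin : scalar f.

Lemma scalarf0 : f 0 = 0.
Proof.
have := f_lin (-1) 0 0; rewrite scaleN1r oppr0 add0r /= => f0.
by lra.
Qed.

Lemma scalarfD x y : f (x + y) = f x + f y.
Proof. by have := f_lin 1 x y; rewrite scale1r /= mul1r. Qed.

Lemma scalarfZ a x : f (a *: x) = a * f x.
Proof. by have := f_lin a x 0; rewrite addr0 scalarf0 addr0. Qed.

Lemma scalarfN x : f (- x) = - f x.
Proof. by rewrite -scaleN1r scalarfZ mulN1r. Qed.

Lemma scalarfB x y : f (x - y) = f x - f y.
Proof. by rewrite scalarfD scalarfN. Qed.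

End Scalar.

Section Star.
Context (R : realType) (X : completeNormedModType R) (n : nat).
Context (a : 'I_n -> X) (phi : 'I_n -> X -> R).
Hypothesis phi_lin : forall i, scalar (phi i).
Hypothesis phi_le : forall (I : {set 'I_n}) v, \sum_(i in I) phi i v <= `|v|.
Hypothesis phi_a : forall i, phi i (a i) = 1.
Hypothesis norm_a : forall i, `|a i| = 1.

(** Two of the functionals taking the value 1 at the same unit vector would add up to 2 there,
    against the bound for pairs. *)
Lemma star_inj : injective a.
Proof.
move=> i j aij; apply/eqP; apply/negPn/negP => ij.
have := phi_le [set i; j]%SET (a i).
by rewrite big_setU1 ?inE//= big_set1 phi_a norm_a aij phi_a; lra.
Qed.

Let V : {fset X} := (0 |` [fset a i | i in 'I_n])%fset.

Let V0 : 0 \in V. Proof. by rewrite !inE eqxx. Qed.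
Let Va i : a i \in V.
Proof. by rewrite !inE; apply/orP; right; apply/imfsetP; exists i. Qed.

Let r : V := [` V0]%fset.
Let q i : V := [` Va i]%fset.

Let rk (x : V) : nat := x != r.

Let rk_par (x : V) : x != r -> (rk r < rk x)%N.
Proof. by rewrite /rk eqxx => ->. Qed.

Definition star : graph_in X := parent_tree (par := fun=> r) rk_par.

Let leaves : [set x | x != r]%SET = [set q i | i : 'I_n]%SET.
Proof.
apply/setP => x; rewrite inE; apply/idP/imsetP => [xr|[i _ ->]]; last first.
  apply/negP => /eqP /(congr1 val) /= ai0.
  by have := norm_a i; rewrite ai0 normr0 => /esym/eqP; rewrite oner_eq0.
have := valP x; rewrite !inE => /orP[/eqP x0|/imfsetP[i _ xa]].
  by case/negP: xr; apply/eqP/val_inj.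
by exists i => //; apply: val_inj.
Qed.

Let card_leaves : #|[set x | x != r]%SET| = n.
Proof.
rewrite leaves card_imset ?card_ord// => i j /(congr1 val) /=.
exact: star_inj.
Qed.

Lemma star_length : total_length star <= n%:R.
Proof.
apply: le_trans (parent_tree_length _) _.
rewrite (eq_bigr (fun=> 1)) => [|x xr]; last first.
  have : x \in [set x | x != r]%SET by rewrite inE.
  by rewrite leaves => /imsetP[i _ ->] /=; rewrite subr0.
by rewrite sumr_const -[in leRHS]card_leaves cardsE.
Qed.

(** Calibration bounds any competitor below by [n] minus the value of the sum of the [phi i] at the
    root. So a root where this sum vanishes is enough: the point 0 if it is a terminal, any node if
    the sum is identically zero. *)
Lemma star_smt (S : {fset X}) :
  (forall i, a i \in S) -> (S `<=` V)%fset ->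
  (0 \in S \/ forall v, \sum_i phi i v = 0) -> steiner_minimal_tree S star.
Proof.
move=> aS SV S0; split; first by split=> //; exact: parent_tree_is_tree.
move=> T [[[/card_gt0P[t _] T_conn] _] /fsubsetP ST].
apply: le_trans star_length _.
have [t' t'0] : exists t' : gvert T, \sum_i phi i (val t') = 0.
  case: S0 => [S0|phi0]; last by exists t.
  exists [` ST _ S0]%fset => /=.
  by rewrite big1// => i _; exact: scalarf0.
have := @calibration R X _ _ val n phi t' (fun i => [` ST _ (aS i)]%fset)
  (@gadj_sym _ T) T_conn (fun i => scalarfB (phi_lin i)) phi_le.
rewrite t'0 subr0; apply: le_trans.
by rewrite (eq_bigr (fun=> 1)) ?sumr_const ?card_ord.
Qed.

Lemma star_vertex_degree : vertex_degrees X n.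
Proof.
exists V, star, r; split; first by apply: star_smt => //; left.
  exact: V0.
rewrite -[RHS]card_leaves /degree; apply: eq_card => y.
by rewrite !inE /= /pedge eqxx /= andbT.
Qed.

Lemma star_steiner_degree : (forall v, \sum_i phi i v = 0) -> steiner_degrees X n.
Proof.
move=> phi0; exists [fset a i | i in 'I_n]%fset, star, r; split.
- apply: star_smt; last by right.
    by move=> i; apply/imfsetP; exists i.
  exact: fsubsetUr.
- apply/negP => /imfsetP[i _ /= ai0].
  by have := norm_a i; rewrite -ai0 normr0 => /esym/eqP; rewrite oner_eq0.
rewrite -[RHS]card_leaves /degree; apply: eq_card => y.
by rewrite !inE /= /pedge eqxx /= andbT.
Qed.

End Star.

(** * The derivative of a smooth norm *)

Section NormDerivative.
Context (R : realType) (X : completeNormedModType R).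
Hypothesis smX : smooth X.
Context (u : X).
Hypothesis u0 : u != 0.

(** For [u] nonzero this turns out to be the unique norming functional of [u]. *)
Definition dnorm (h : X) : R := 'D_h (fun y : X => `|y| : R^o) u.

Lemma dnorm_near h (eps : R) : 0 < eps -> exists2 delta : R, 0 < delta &
  forall t, t != 0 -> `|t| < delta ->
    `|(`|u + t *: h| - `|u|) - t * dnorm h| <= eps * `|t|.
Proof.
move=> eps0; have /cvgrPdist_le/(_ eps eps0) := @smX u h u0.
rewrite -nbhs_nearE => -[delta /= delta0 near_delta].
exists delta => // t t0 t_lt.
have := near_delta t; rewrite /ball_ /= sub0r normrN => /(_ t_lt t0).
rewrite -/(derive (fun y : X => `|y| : R^o) u h) -/(dnorm h) => le_eps.
have t_gt0 : 0 < `|t| by rewrite normr_gt0.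
have -> : `|u + t *: h| - `|u| - t * dnorm h =
   - t * (dnorm h - t^-1 *: ((`|t *: h + u| : R^o) - `|u|)).
  rewrite [u + _]addrC -[_ *: (_ : R^o)]/(_ * _); field.
  by rewrite t0.
by rewrite normrM normrN mulrC ler_pM2r.
Qed.

(** A convex function lies above its tangents: a violation at [t] forces one at [s * t] at least [s]
    times as large, whereas differentiability makes it of smaller order than [s]. *)
Lemma dnorm_support h t : `|u| + t * dnorm h <= `|u + t *: h|.
Proof.
have [->|t0] := eqVneq t 0; first by rewrite mul0r scale0r !addr0.
have t_gt0 : 0 < `|t| by rewrite normr_gt0.
rewrite leNgt; apply/negP => lt.
(* With this [eps] the error allowed at [s * t] is half of the violation that convexity forces
   there. *)
pose eps := (`|u| + t * dnorm h - `|u + t *: h|) / (2 * `|t|).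
have eps0 : 0 < eps by rewrite divr_gt0 ?subr_gt0// mulr_gt0.
have [delta delta0 near_delta] := dnorm_near h eps0.
pose s := Num.min 1 (delta / (2 * `|t|)).
have s0 : 0 < s by rewrite lt_min ltr01 divr_gt0// mulr_gt0.
have s1 : s <= 1 by rewrite ge_min lexx.
have st0 : s * t != 0 by rewrite mulf_neq0// gt_eqF.
have st_lt : `|s * t| < delta.
  rewrite normrM gtr0_norm//.
  have : s <= delta / (2 * `|t|) by rewrite ge_min lexx orbT.
  rewrite ler_pdivlMr ?mulr_gt0// => le_delta.
  have -> : s * `|t| = s * (2 * `|t|) / 2 by field.
  by rewrite ltr_pdivrMr// (le_lt_trans le_delta)// ltr_pMr//; lra.
have := near_delta _ st0 st_lt; rewrite ler_norml => /andP[+ _].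
rewrite normrM (gtr0_norm s0) => lower.
have conv : `|u + (s * t) *: h| <= (1 - s) * `|u| + s * `|u + t *: h|.
  have -> : u + (s * t) *: h = (1 - s) *: u + s *: (u + t *: h).
    by rewrite scalerDr scalerA scalerBl scale1r addrA subrK.
  apply: le_trans (ler_normD _ _) _.
  by rewrite !normrZ (gtr0_norm s0) ger0_norm// subr_ge0.
have epsE : eps * (s * `|t|) = s * (`|u| + t * dnorm h - `|u + t *: h|) / 2.
  by rewrite /eps; field; rewrite gt_eqF.
have : 0 < s * (`|u| + t * dnorm h - `|u + t *: h|) by rewrite mulr_gt0// subr_gt0.
move: lower conv; rewrite epsE; lra.
Qed.

(** A supporting line at a point of differentiability is the tangent: the increments at a small [t]
    and at [- t] bound [c] from above and from below. *)
Lemma dnorm_unique h c : (forall t, `|u| + t * c <= `|u + t *: h|) -> c = dnorm h.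
Proof.
move=> c_le; apply/eqP; rewrite -subr_eq0 -normr_eq0 eq_le normr_ge0 andbT.
apply/ler_addgt0Pr => eps eps0; rewrite add0r.
have [delta delta0 near_delta] := dnorm_near h eps0.
pose t := delta / 2.
have t0 : 0 < t by rewrite divr_gt0.
have t_lt : `|t| < delta by rewrite gtr0_norm// ltr_pdivrMr// ltr_pMr//; lra.
have := near_delta t; rewrite gt_eqF// => /(_ isT t_lt).
have := near_delta (- t); rewrite oppr_eq0 gt_eqF// normrN => /(_ isT t_lt).
have := c_le t; have := c_le (- t).
rewrite (gtr0_norm t0) !ler_norml => ? ? /andP[? ?] /andP[? ?].
apply/andP; split; rewrite -(ler_pM2l t0); lra.
Qed.

Lemma dnormZ c h : dnorm (c *: h) = c * dnorm h.
Proof.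
apply/esym/dnorm_unique => t.
by rewrite scalerA mulrA; exact: dnorm_support.
Qed.

(** The point [u + (t / 2) *: (h + k)] is the midpoint of [u + t *: h] and [u + t *: k]. Applied to
    the opposite vectors, this also yields the reverse inequality. *)
Let dnormD_le h k : dnorm (h + k) <= dnorm h + dnorm k.
Proof.
apply/ler_addgt0Pr => eps eps0.
have e2 : 0 < eps / 2 by rewrite divr_gt0.
have [d1 d1_gt0 near1] := dnorm_near h e2.
have [d2 d2_gt0 near2] := dnorm_near k e2.
pose t := Num.min d1 d2 / 2.
have m0 : 0 < Num.min d1 d2 by rewrite lt_min d1_gt0.
have t0 : 0 < t by rewrite divr_gt0.
have t_lt : t < Num.min d1 d2 by rewrite ltr_pdivrMr// ltr_pMr//; lra.
have t2 : 0 < t / 2 by rewrite divr_gt0.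
have := near1 t; have := near2 t.
rewrite (gtr0_norm t0) (gt_eqF t0) => /(_ isT) nk /(_ isT) nh.
have := nh (lt_le_trans t_lt _); rewrite ge_min lexx => /(_ isT).
have := nk (lt_le_trans t_lt _); rewrite ge_min lexx orbT => /(_ isT).
rewrite !ler_norml => /andP[_ k_le] /andP[_ h_le].
have := dnorm_support (h + k) (t / 2).
have : `|u + (t / 2) *: (h + k)| <= (`|u + t *: h| + `|u + t *: k|) / 2.
  have -> : u + (t / 2) *: (h + k) = 2^-1 *: ((u + t *: h) + (u + t *: k)).
    rewrite addrACA -scalerDr [RHS]scalerDr scalerA [t / 2]mulrC; congr (_ + _).
    by rewrite -[in RHS](scale1r u) -scalerDl scalerA mulVf ?scale1r.
  rewrite normrZ ger0_norm ?invr_ge0// mulrC ler_pM2r ?invr_gt0//.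
  exact: ler_normD.
move=> ? ?; rewrite -(ler_pM2l t0); lra.
Qed.

Lemma dnorm_scalar : scalar dnorm.
Proof.
move=> c h k; rewrite -dnormZ; apply/eqP; rewrite eq_le dnormD_le /=.
have dnormN x : dnorm (- x) = - dnorm x by rewrite -scaleN1r dnormZ mulN1r.
have := dnormD_le (- (c *: h)) (- k).
by rewrite -opprD !dnormN; lra.
Qed.

Lemma dnorm_self : dnorm u = `|u|.
Proof.
apply/esym/dnorm_unique => t; rewrite -{3}[u]scale1r -scalerDl normrZ.
rewrite -[X in X + _]mul1r -mulrDl ler_pM2r ?normr_gt0// ler_norm//.
Qed.

(** A norming functional of [u] gives a supporting line at [u] in every direction. *)
Lemma dnorm_norming (psi : X -> R) : scalar psi -> (forall x, psi x <= `|x|) ->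
  psi u = `|u| -> psi = dnorm.
Proof.
move=> psi_lin psi_le psi_u; apply/funext => h; apply: dnorm_unique => t.
by rewrite -psi_u -(scalarfZ psi_lin) -(scalarfD psi_lin).
Qed.

End NormDerivative.

(** * First variation at a vertex *)

Lemma sum_option (R : nmodType) (V : finType) (P : pred (option V)) (F : option V -> R) :
  \sum_(a | P a) F a =
    (if P None then F None else 0) + \sum_(v : V | P (Some v)) F (Some v).
Proof.
rewrite (bigID (fun a : option V => a == None)) /=; congr (_ + _).
  rewrite big_mkcond (bigD1 None) //= eqxx andbT big1 ?addr0// => a aN.
  by rewrite (negPf aN) andbF.
rewrite (reindex_omap Some id) /=; last by case=> [//|]; rewrite eqxx andbF.
apply: eq_bigl => v; rewrite andbT.
by rewrite eqxx andbT.
Qed.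

(* Detach the edges from [x] to [I] and reattach them to a new node [None] joined to [x]. *)
Section Splitting.
Context (R : realType) (X : completeNormedModType R) (S : {fset X}).
Context (T : graph_in X) (x : gvert T) (I : {set gvert T}).
Hypothesis T_smt : steiner_minimal_tree S T.
Hypothesis adj_I : forall y, y \in I -> gadj x y.

Let moved (a b : gvert T) := (a == x) && (b \in I) || (b == x) && (a \in I).

Let split_edge : rel (option (gvert T)) := fun a b =>
  match a, b with
  | Some a, Some b => gadj a b && ~~ moved a b
  | None, Some y | Some y, None => (y == x) || (y \in I)
  | None, None => false
  end.

Let split_pos (w : X) (a : option (gvert T)) : X :=
  if a is Some y then val y else w.

Let split_sym : symmetric split_edge.
Proof. by move=> [a|] [b|] //=; rewrite gadj_sym /moved orbC. Qed.

(** A moved edge is replaced by the detour through [None]. *)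
Let split_conn a b : connect split_edge a b.
Proof.
have Nx : connect split_edge None (Some x) by apply: connect1; rewrite /= eqxx.
have xN : connect split_edge (Some x) None by apply: connect1; rewrite /= eqxx.
have step y z : gadj y z -> connect split_edge (Some y) (Some z).
  move=> yz; have [/orP[]/andP[/eqP-> I_]|nm] := boolP (moved y z).
  - by apply: connect_trans xN _; apply: connect1; rewrite /= I_ orbT.
  - by apply: connect_trans Nx; apply: connect1; rewrite /= I_ orbT.
  - by apply: connect1; rewrite /= yz.
have some y z : connect split_edge (Some y) (Some z).
  have [[[_ T_conn] _] _] := T_smt.1.
  have /connectP[s] := T_conn y z.
  elim: s y => [y _ ->//|y' s IHs y /= /andP[yy' s_path] zE].
  by apply: connect_trans (step _ _ yy') _; exact: IHs.
by case: a b => [a|] [b|] //; [apply: connect_trans xN|apply: connect_trans Nx _].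
Qed.

(** The split network still reaches [S], so it is no shorter than [T]. The edges common to both
    cancel, leaving the moved edges against their replacements and the new edge at [x]. *)
Lemma split_length (w : X) :
  \sum_(y in I) `|val y - val x| <= `|w - val x| + \sum_(y in I) `|val y - w|.
Proof.
have [[T_tree /fsubsetP ST] T_min] := T_smt.
have S_img z : z \in S -> exists a, split_pos w a = z.
  by move=> zS; exists (Some [` ST _ zS]%fset).
have [T' T'S T'_le] := network_tree (Some x) split_sym split_conn S_img.
have {T' T'S T'_le} := le_trans (T_min _ T'S) T'_le.
rewrite /total_length /net_length ler_pM2l ?invr_gt0//.
have xI : x \notin I by apply/negP => /adj_I; rewrite gadj_irr.
pose F (a b : gvert T) := `|val a - val b|.
have sum_nbr : \sum_(y | (y == x) || (y \in I)) `|w - val y| =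
    `|w - val x| + \sum_(y in I) `|val y - w|.
  rewrite (bigD1 x) ?eqxx//=; congr (_ + _).
  apply: eq_big => [y|y _]; last by rewrite distrC.
  by have [->|] := eqVneq y x; rewrite ?andbF ?andbT//= (negPf xI).
have -> : \sum_a \sum_(b | split_edge a b) `|split_pos w a - split_pos w b| =
    \sum_a \sum_(b | gadj a b && ~~ moved a b) F a b +
    2 * (`|w - val x| + \sum_(y in I) `|val y - w|).
  rewrite sum_option /= sum_option /= add0r sum_nbr.
  under eq_bigr do rewrite sum_option /=.
  rewrite big_split /= -big_mkcond /=.
  set D := `|w - val x| + _; set C := \sum_a \sum_(b | _) F a b.
  transitivity (D + (D + C)); last by ring.
  congr (_ + (_ + _)); rewrite /D -sum_nbr.
  by apply: eq_bigr => y _; exact: distrC.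
have -> : \sum_(a : gvert T) \sum_(b | gadj a b) `|val a - val b| =
    \sum_a \sum_(b | gadj a b && ~~ moved a b) F a b +
    2 * \sum_(y in I) `|val y - val x|.
  rewrite (eq_bigr (fun a => \sum_(b | gadj a b && ~~ moved a b) F a b +
    \sum_(b | gadj a b && moved a b) F a b)) => [|a _]; last first.
    by rewrite (bigID (moved a)) /= addrC.
  rewrite big_split /=; congr (_ + _).
  rewrite (bigD1 x) //= mulr_natl mulr2n; congr (_ + _).
    apply: eq_big => [y|y _]; last by rewrite distrC.
    rewrite /moved eqxx /= (negPf xI) andbF orbF.
    by apply/andP/idP => [[]//|yI]; rewrite yI adj_I.
  rewrite [RHS](eq_bigl (fun y => (y != x) && (y \in I))) => [|y]; last first.
    by have [->|//] := eqVneq y x; rewrite (negPf xI).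
  rewrite [RHS]big_mkcondr /=; apply: eq_bigr => y yx.
  rewrite [LHS](eq_bigl (fun b => (b == x) && (y \in I))) => [|b]; last first.
    rewrite /moved (negPf yx) /=; apply/andP/idP => [[]//|/andP[/eqP-> yI]].
    by rewrite eqxx yI gadj_sym adj_I.
  case: (y \in I); last by rewrite big1// => b; rewrite andbF.
  by rewrite (eq_bigl _ _ (fun b => andbT (b == x))) big_pred1_eq.
lra.
Qed.

Hypothesis smX : smooth X.

(** Place the new node at [x + t v]. To first order the edges to [I] shorten by [t] times the sum on
    the left, and the new edge costs [t] times the norm of [v]. *)
Lemma first_variation v : \sum_(y in I) dnorm (val y - val x) v <= `|v|.
Proof.
have u0 y : y \in I -> val y - val x != 0.
  move=> yI; rewrite subr_eq0; apply/negP => /eqP/val_inj yx.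
  by have := adj_I yI; rewrite yx gadj_irr.
apply/ler_addgt0Pr => eps eps0.
(* The error [eps] is shared among the edges; the added 1 keeps [N] positive when [I] is empty. *)
pose N : R := #|I|%:R + 1.
have N0 : 0 < N by rewrite ltr_wpDl.
have eN : 0 < eps / N by rewrite divr_gt0.
have near_y (y : gvert T) : exists delta : R, y \in I -> 0 < delta /\
  forall t, t != 0 -> `|t| < delta -> `|(`|val y - val x + t *: v| - `|val y - val x|)
     - t * dnorm (val y - val x) v| <= eps / N * `|t|.
  have [yI|_] := boolP (y \in I); last by exists 0.
  by have [delta delta0 H] := dnorm_near smX (u0 _ yI) v eN; exists delta.
have [delta deltaP] := choice near_y.
have [t t0 t_lt] : exists2 t : R, 0 < t & forall y, y \in I -> t < delta y.
  exists (\big[Num.min/1]_(y in I) delta y / 2).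
    rewrite divr_gt0//; elim/big_ind: _ => // [a b a0 b0|y /deltaP[]//].
    by rewrite lt_min a0.
  move=> y yI; have [dy _] := deltaP y yI.
  apply: (@le_lt_trans _ _ (delta y / 2)); last by rewrite ltr_pdivrMr// ltr_pMr//; lra.
  by rewrite ler_pM2r ?invr_gt0//; exact: bigmin_le_cond.
have := split_length (t *: v + val x).
rewrite addrK => split_le.
have : \sum_(y in I) `|val y - (t *: v + val x)| <=
    \sum_(y in I) (`|val y - val x| - t * dnorm (val y - val x) v + eps / N * t).
  apply: ler_sum => y yI; have [_ /(_ (- t))] := deltaP y yI.
  rewrite oppr_eq0 gt_eqF// normrN gtr0_norm// => /(_ isT (t_lt _ yI)).
  have -> : val y - (t *: v + val x) = val y - val x + (- t) *: v.
    by rewrite scaleNr opprD addrCA addrC.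
  by rewrite ler_norml => /andP[_]; lra.
rewrite big_split sumrB /= -mulr_sumr sumr_const => sum_le.
have : eps / N * t *+ #|I| <= eps * t.
  have -> : eps / N * t *+ #|I| = eps * t * (#|I|%:R / N) by rewrite -mulr_natr; ring.
  apply: ler_piMr; first by rewrite mulr_ge0 ?ltW.
  by rewrite ler_pdivrMr// mul1r lerDl.
move: split_le; rewrite normrZ (gtr0_norm t0) => ? ?.
rewrite -(ler_pM2l t0); lra.
Qed.

End Splitting.

(** * The dimension bound *)

Lemma has_dim_basis (R : realType) (X : completeNormedModType R) (d : nat) :
  has_dim d X -> exists (c : 'I_d -> X -> R) (b : 'I_d -> X),
    [/\ forall k, scalar (c k), forall x, x = \sum_k c k x *: b k
      & forall k l, c k (b l) = (k == l)%:R].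
Proof.
case=> -[v2r v2r_lin [r2v r2vK v2rK]].
pose c k x := v2r x 0 k; pose b k := r2v (delta_mx 0 k).
have c_lin k : scalar (c k) by move=> a x y; rewrite /c v2r_lin !mxE.
exists c, b; split=> // [x|k l]; last first.
  by rewrite /c /b v2rK mxE eqxx.
apply: (can_inj r2vK); rewrite {1}(row_sum_delta (v2r x)).
have v2r0 : v2r 0 = 0 by apply/rowP => k; rewrite mxE -/(c k 0) (scalarf0 (c_lin k)).
have v2rD y z : v2r (y + z) = v2r y + v2r z.
  by apply/rowP => k; rewrite mxE -/(c k _) (scalarfD (c_lin k)).
have v2rZ r y : v2r (r *: y) = r *: v2r y.
  by apply/rowP => k; rewrite mxE -/(c k _) (scalarfZ (c_lin k)).
rewrite (big_morph v2r v2rD v2r0); apply: eq_bigr => k _.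
by rewrite v2rZ v2rK.
Qed.

Lemma scalarf_sum (R : realType) (X : lmodType R) (f : X -> R) (I : finType)
    (c : I -> R) (b : I -> X) :
  scalar f -> f (\sum_k c k *: b k) = \sum_k c k * f (b k).
Proof.
move=> f_lin; rewrite (big_morph f (scalarfD f_lin) (scalarf0 f_lin)).
by apply: eq_bigr => k _; rewrite (scalarfZ f_lin).
Qed.

Section DimensionBound.
Context (R : realType) (X : completeNormedModType R) (d n : nat).
Context (u : 'I_n -> X) (phi : 'I_n -> X -> R).
Hypothesis dimX : has_dim d X.
Hypothesis phi_lin : forall i, scalar (phi i).

(** There is one equation per basis vector, plus the normalisation [x i0 = 0] encoded by the last
    column of [A]: [d + 1] equations in more than [d + 1] unknowns. The normalisation excludes
    nonzero constant solutions. *)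
Lemma scalar_dependence (i0 : 'I_n) : (d.+1 < n)%N ->
  exists x : 'I_n -> R, [/\ x i0 = 0, exists i, x i != 0
    & forall v, \sum_i x i * phi i v = 0].
Proof.
move=> dn; have [c [b [_ cb _]]] := has_dim_basis dimX.
pose A : 'M[R]_(n, d + 1) :=
  row_mx (\matrix_(i, k) phi i (b k)) (\col_i (i == i0)%:R).
have /rowV0Pn[x] : kermx A != 0.
  rewrite kermx_eq0 /row_free neq_ltn; apply/orP; left.
  by rewrite (leq_ltn_trans (rank_leq_col A))// addn1.
move=> /sub_kermxP; rewrite mul_mx_row => /(congr1 (fun B => (lsubmx B, rsubmx B))).
rewrite row_mxKl row_mxKr !linear0 => -[/rowP xphi /rowP xi0] x0.
exists (x 0); split=> [||v].
- have := xi0 0; rewrite !mxE (bigD1 i0) //= big1 => [|i ii0]; last first.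
    by rewrite mxE (negPf ii0) mulr0.
  by rewrite !mxE eqxx mulr1 addr0 => ->.
- have /rV0Pn[i xi] := x0.
  by exists i.
- rewrite (eq_bigr (fun i => \sum_k x 0 i * (c k v * phi i (b k)))) => [|i _].
    rewrite exchange_big big1// => k _ /=.
    under eq_bigr do rewrite mulrCA.
    rewrite -mulr_sumr; have := xphi k; rewrite !mxE => xphi_k.
    rewrite [X in _ * X](_ : _ = 0) ?mulr0// -[RHS]xphi_k.
    by apply: eq_bigr => i _; rewrite mxE.
  by rewrite -mulr_sumr -(scalarf_sum _ _ (phi_lin i)) -cb.
Qed.

Hypothesis u0 : forall i, u i != 0.
Hypothesis phi_le : forall (I : {set 'I_n}) v, \sum_(i in I) phi i v <= `|v|.
Hypothesis phi_u : forall i, phi i (u i) = `|u i|.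
Hypothesis phi_unique : forall i (psi : X -> R), scalar psi ->
  (forall v, psi v <= `|v|) -> psi (u i) = `|u i| -> psi = phi i.

(** The bound for the pair, taken at [u i], leaves no room for a positive value. If the value were
    0, [phi i + phi j] would also norm [u i], so by uniqueness [phi j] would vanish, even at
    [u j]. *)
Let phi_neg i j : i != j -> phi j (u i) < 0.
Proof.
move=> ij; have phi_ij v : phi i v + phi j v <= `|v|.
  by have := phi_le [set i; j]%SET v; rewrite big_setU1 ?inE//= big_set1.
rewrite lt_neqAle; apply/andP; split; last first.
  by have := phi_ij (u i); rewrite phi_u gerDl.
apply/eqP => phi0.
have psi_lin : scalar (fun v => phi i v + phi j v).
  by move=> a x y /=; rewrite (phi_lin i) (phi_lin j); ring.
have : (fun v => phi i v + phi j v) = phi i.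
  by apply: phi_unique => //; rewrite phi0 addr0 phi_u.
move=> /(congr1 (@^~ (u j))) /eqP; rewrite addrC -subr_eq0 addrK phi_u normr_eq0.
by rewrite (negPf (u0 j)).
Qed.

(* Maximum principle: [phi j (u i)] is a weakly diagonally dominant matrix with
   negative off-diagonal entries, so its kernel contains only constants. *)
Let dependence_le0 (x : 'I_n -> R) i0 : x i0 = 0 ->
  (forall v, \sum_i x i * phi i v = 0) -> forall i, x i <= 0.
Proof.
move=> xi0 x_dep; case: (@arg_maxP _ _ _ i0 predT x) => // i _ x_max j.
apply: le_trans (x_max j isT) _; rewrite leNgt; apply/negP => xi_gt0.
have ii0 : i != i0 by apply: contraTneq xi_gt0 => ->; rewrite xi0 ltxx.
have := x_dep (u i); rewrite (bigD1 i)//= phi_u.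
have : - `|u i| <= \sum_(j | j != i) phi j (u i).
  have := phi_le [set j | j != i]%SET (- u i).
  rewrite normrN (eq_bigl (fun j => j != i)) => [|k]; last by rewrite inE.
  under eq_bigr do rewrite (scalarfN (phi_lin _)).
  by rewrite sumrN lerNl.
rewrite -(ler_pM2l xi_gt0) mulr_sumr => sum_ge.
have : \sum_(j | j != i) x i * phi j (u i) < \sum_(j | j != i) x j * phi j (u i).
  rewrite [ltLHS](bigD1 i0) ?[ltRHS](bigD1 i0) 1?eq_sym//= xi0 mul0r.
  apply: ltr_leD; first by rewrite pmulr_rlt0// phi_neg.
  apply: ler_sum => k /andP[ki _]; apply: ler_wnM2r; last exact: x_max.
  by rewrite ltW// phi_neg// eq_sym.
move: sum_ge; rewrite mulrN => ? ? ?; lra.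
Qed.

Lemma dimension_bound : (n <= d.+1)%N.
Proof.
rewrite leqNgt; apply/negP => dn.
have i0 : 'I_n by apply: Ordinal (leq_ltn_trans (leq0n _) dn).
have [x [xi0 [i /eqP xi] x_dep]] := scalar_dependence i0 dn.
apply: xi; apply/eqP; rewrite eq_le (dependence_le0 xi0 x_dep) /=.
rewrite -oppr_le0.
(* The maximum principle for [- x] bounds [x] from below, so the dependence is trivial. *)
apply: (@dependence_le0 (fun i => - x i) i0); first by rewrite xi0 oppr0.
by move=> v; under eq_bigr do rewrite mulNr; rewrite sumrN x_dep oppr0.
Qed.

End DimensionBound.

(** * Norming vectors *)

Local Open Scope classical_set_scope.
Local Open Scope ring_scope.

(** * Degrees in minimal trees *)

Section Degrees.
Context (R : realType) (X : completeNormedModType R).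

Lemma smt_functionals (S : {fset X}) (T : graph_in X) (x : gvert T) :
  smooth X -> steiner_minimal_tree S T ->
  exists2 u : 'I_(degree x) -> X, forall i, u i != 0 &
    forall (I : {set 'I_(degree x)}) v, \sum_(i in I) dnorm (u i) v <= `|v|.
Proof.
move=> smX T_smt; pose y (i : 'I_(degree x)) : gvert T := enum_val i.
have xy i : gadj x (y i) by have := enum_valP i; rewrite inE.
exists (fun i => val (y i) - val x) => [i|I v].
  rewrite subr_eq0; apply/negP => /eqP/val_inj yx.
  by have := xy i; rewrite yx gadj_irr.
have adj_yI z : z \in [set y i | i in I]%SET -> gadj x z.
  by move=> /imsetP[i _ ->].
have := first_variation T_smt adj_yI smX v.
by rewrite big_imset//= => i j _ _; exact: enum_val_inj.
Qed.

(** Declare every node of the tree a terminal: the tree stays minimal, because there are fewer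
    competitors. *)
Lemma steiner_degree_vertex n : steiner_degrees X n -> vertex_degrees X n.
Proof.
move=> [S [T [x [[[T_tree ST] T_min] _ x_n]]]].
exists (gvert T), T, x; split=> //; last exact: valP.
split=> [|T' [T'_tree TT']]; first by split=> //; exact: fsubset_refl.
by apply: T_min; split=> //; exact: fsubset_trans TT'.
Qed.

Lemma vertex_degree_le (d n : nat) : has_dim d X -> smooth X ->
  vertex_degrees X n -> (n <= d.+1)%N.
Proof.
move=> dimX smX [S [T [x [T_smt _ <-]]]].
have [u u0 u_le] := smt_functionals x smX T_smt.
apply: (@dimension_bound R X d _ u (fun i => dnorm (u i))) => // i.
- exact: dnorm_scalar.
- exact: dnorm_self.
- by move=> psi; exact: dnorm_norming.
Qed.

End Degrees.

Lemma exists_largest (A : set nat) (m b : nat) :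
  A m -> (forall n, A n -> (n <= b)%N) -> exists2 n, is_largest A n & (m <= n)%N.
Proof.
move=> Am Ab.
have exA : exists n, `[< A n >] by exists m; apply/asboolP.
have ubA n : `[< A n >] -> (n <= b)%N by move=> /asboolP/Ab.
have [n /asboolP An n_max] := ex_maxnP exA ubA.
by exists n; [split=> // k Ak|]; apply: n_max; apply/asboolP.
Qed.

(** * Compactness of the unit sphere *)

Lemma lipschitz_continuous_mx (R : realType) (d : nat) (h : 'rV[R]_d -> R) (K : R) :
  (forall a a', `|h a - h a'| <= K * `|a - a'|) -> continuous h.
Proof.
move=> h_lip a; apply/(@cvgrPdist_le _ _ _ _ (nbhs_filter a)) => eps eps0.
have K0 : 0 < `|K| + 1 by rewrite ltr_wpDl.
rewrite -nbhs_nearE; apply/(@nbhs_normP R _ a).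
exists (eps / (`|K| + 1)) => /=; first by rewrite divr_gt0.
move=> a' /= aa'; apply: le_trans (h_lip _ _) _.
apply: (@le_trans _ _ ((`|K| + 1) * `|a - a'|)).
  by rewrite ler_wpM2r// (le_trans (ler_norm _))// lerDl.
by rewrite mulrC -ler_pdivlMr// ltW.
Qed.

Lemma rV_sphere_compact (R : realType) (d : nat) :
  compact [set a : 'rV[R]_d | `|a| = 1].
Proof.
apply: bounded_closed_compact; first by exists 1; split=> // x x1 a /= ->; exact: ltW.
apply: (@closed_comp _ _ (fun a : 'rV[R]_d => `|a|) [set 1 : R]); last exact: closed_eq.
by move=> a _; exact: norm_continuous.
Qed.

(** A continuous function attains its maximum on a compact sphere. In coordinates the unit sphere of
    [X] is bounded because the norm is at least [m] times the sup norm, [m] being its positive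
    minimum on the sup-norm sphere. *)
Lemma exists_norming (R : realType) (X : completeNormedModType R) (d : nat)
    (f : X -> R) : (0 < d)%N -> has_dim d X -> scalar f ->
  exists2 x : X, `|x| = 1 & forall y, f y <= f x * `|y|.
Proof.
move=> d0 dimX f_lin; have [c [b [c_lin cb cbE]]] := has_dim_basis dimX.
pose emb (a : 'rV[R]_d) : X := \sum_k a 0 k *: b k.
have embB a a' : emb a - emb a' = emb (a - a').
  by rewrite /emb -sumrB; apply: eq_bigr => k _; rewrite !mxE scalerBl.
have embZ r a : emb (r *: a) = r *: emb a.
  by rewrite /emb scaler_sumr; apply: eq_bigr => k _; rewrite mxE scalerA.
have emb_surj y : exists a, emb a = y.
  by exists (\row_k c k y); rewrite [RHS](cb y); apply: eq_bigr => k _; rewrite mxE.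
have emb_inj a : emb a = 0 -> a = 0.
  move=> a0; apply/rowP => k; rewrite mxE.
  have := scalarf0 (c_lin k); rewrite -a0 (scalarf_sum _ _ (c_lin k)) (bigD1 k)//=.
  rewrite cbE eqxx mulr1 big1 ?addr0// => l lk.
  by rewrite cbE eq_sym (negPf lk) mulr0.
have coord_le (a : 'rV[R]_d) k : `|a 0 k| <= `|a|.
  rewrite -[leRHS]/(mx_norm a) mx_normrE; apply/bigmax_geP; right => /=.
  by exists (0, k).
pose K := \sum_k `|b k|; pose Kf := \sum_k `|f (b k)|.
have emb_le a : `|emb a| <= K * `|a|.
  rewrite /K mulr_suml; apply: le_trans (ler_norm_sum _ _ _) _.
  by apply: ler_sum => k _; rewrite normrZ mulrC ler_wpM2l.
have g_cont : continuous (fun a => `|emb a|).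
  apply: (@lipschitz_continuous_mx _ _ _ K) => a a'.
  by apply: le_trans (emb_le _); rewrite -embB ler_dist_dist.
have f_cont : continuous (fun a => f (emb a)).
  apply: (@lipschitz_continuous_mx _ _ _ Kf) => a a'.
  rewrite -(scalarfB f_lin) embB (scalarf_sum _ _ f_lin) /Kf mulr_suml.
  apply: le_trans (ler_norm_sum _ _ _) _.
  by apply: ler_sum => k _; rewrite normrM mulrC ler_wpM2l.
have [a0 a0_neq0] : exists a : 'rV[R]_d, a != 0.
  exists (delta_mx 0 (Ordinal d0)); apply/negP => /eqP/rowP/(_ (Ordinal d0)).
  by rewrite !mxE !eqxx => /eqP; rewrite oner_eq0.
have normalize (a : 'rV[R]_d) : a != 0 -> `| `|a|^-1 *: a| = 1.
  by move=> an; rewrite normrZ ger0_norm ?invr_ge0// mulVf// normr_eq0.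
have [m m_gt0 m_le] : exists2 m, 0 < m & forall a, m * `|a| <= `|emb a|.
  have [|a] := EVT_min_rV _ (@rV_sphere_compact R d) (continuous_subspaceT g_cont).
    by exists (`|a0|^-1 *: a0); exact: normalize.
  rewrite inE /= => a1 a_min; exists `|emb a|.
    rewrite normr_gt0; apply/negP => /eqP/emb_inj aE.
    by move: a1; rewrite aE normr0 => /esym/eqP; rewrite oner_eq0.
  move=> a'; have [->|a'0] := eqVneq a' 0; first by rewrite normr0 mulr0.
  have := a_min (`|a'|^-1 *: a'); rewrite inE /= => /(_ (normalize _ a'0)).
  rewrite embZ normrZ ger0_norm ?invr_ge0// => le_a'.
  by rewrite -ler_pdivlMr ?normr_gt0// mulrC.
have ball_compact : compact [set a | `|emb a| = 1].
  apply: bounded_closed_compact.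
    exists (m^-1); split; first exact: num_real.
    move=> r r_gt a /= a1; apply: le_trans (ltW r_gt).
    by rewrite -[leRHS]mul1r ler_pdivlMr// mulrC -a1.
  apply: (@closed_comp _ _ (fun a => `|emb a|) [set 1 : R]); last exact: closed_eq.
  by move=> a _; exact: g_cont.
have normalizeX a : a != 0 -> `|emb (`|emb a|^-1 *: a)| = 1.
  move=> an; rewrite embZ normrZ ger0_norm ?invr_ge0// mulVf// normr_eq0.
  by apply: contra_neq an; exact: emb_inj.
have [|a] := EVT_max_rV _ ball_compact (continuous_subspaceT f_cont).
  by exists (`|emb a0|^-1 *: a0); exact: normalizeX.
rewrite inE /= => a1 a_max; exists (emb a) => // y.
have [a' <-] := emb_surj y; have [->|a'0] := eqVneq a' 0.
  have -> : emb 0 = 0 by rewrite /emb big1// => k _; rewrite mxE scale0r.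
  by rewrite (scalarf0 f_lin) normr0 mulr0.
have := a_max (`|emb a'|^-1 *: a'); rewrite inE => /(_ (normalizeX _ a'0)).
rewrite embZ (scalarfZ f_lin) mulrC ler_pdivrMr// normr_gt0.
by apply: contra_neq a'0; exact: emb_inj.
Qed.

(** * A Steiner point of degree 3 *)

Section ThreeFunctionals.
Context (R : realType) (X : completeNormedModType R) (d : nat).
Hypothesis d2 : (2 <= d)%N.
Hypothesis dimX : has_dim d X.

Let d0 : (0 < d)%N. Proof. exact: leq_trans d2. Qed.

(** [D s t] is the dual norm of [s f + t g], characterised as a bound that is attained on the unit
    sphere. *)
Let exists_dual_norm (f g : X -> R) : scalar f -> scalar g ->
  exists D : R -> R -> R,
    (forall s t y, s * f y + t * g y <= D s t * `|y|) /\
    (forall s t, exists2 x, `|x| = 1 & s * f x + t * g x = D s t).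
Proof.
move=> f_lin g_lin.
have norming (st : R * R) : exists x : X, `|x| = 1 /\ forall y,
    st.1 * f y + st.2 * g y <= (st.1 * f x + st.2 * g x) * `|y|.
  have fg_lin : scalar (fun y => st.1 * f y + st.2 * g y).
    by move=> a x y /=; rewrite f_lin g_lin /=; ring.
  by have [x x1 x_max] := exists_norming d0 dimX fg_lin; exists x.
have [x xP] := choice norming.
exists (fun s t => s * f (x (s, t)) + t * g (x (s, t))); split=> [s t y|s t].
  by have [_ /(_ y)] := xP (s, t).
by exists (x (s, t)) => //; have [] := xP (s, t).
Qed.

(** [D] is Lipschitz: compare two functionals at a unit vector norming one of them. The maps [p] and
    [q] describe a curve in the dual plane. *)
Let dual_norm_continuous (f g : X -> R) (D : R -> R -> R) (p q : R -> R) :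
  scalar f -> scalar g ->
  (forall s t y, s * f y + t * g y <= D s t * `|y|) ->
  (forall s t, exists2 x, `|x| = 1 & s * f x + t * g x = D s t) ->
  continuous p -> continuous q -> continuous (fun r => D (p r) (q r)).
Proof.
move=> f_lin g_lin D_le D_attained p_cont q_cont.
pose M := `|D 1 0| + `|D (-1) 0| + `|D 0 1| + `|D 0 (-1)|.
have fg_le x : `|x| = 1 -> `|f x| <= M /\ `|g x| <= M.
  move=> x1; have := D_le 1 0 x; have := D_le (-1) 0 x.
  have := D_le 0 1 x; have := D_le 0 (-1) x; rewrite x1 !mulr1 !ler_norml /M.
  have := ler_norm (D 1 0); have := ler_norm (D (-1) 0).
  have := ler_norm (D 0 1); have := ler_norm (D 0 (-1)).
  have := normr_ge0 (D 1 0); have := normr_ge0 (D (-1) 0).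
  have := normr_ge0 (D 0 1); have := normr_ge0 (D 0 (-1)).
  by move=> *; split; apply/andP; split; lra.
have D_diff s t s' t' : D s t - D s' t' <= M * (`|s - s'| + `|t - t'|).
  have [x x1 <-] := D_attained s t; have [fM gM] := fg_le x x1.
  have := D_le s' t' x; rewrite x1 mulr1.
  have : (s - s') * f x <= `|s - s'| * M.
    by apply: le_trans (ler_norm _) _; rewrite normrM ler_wpM2l.
  have : (t - t') * g x <= `|t - t'| * M.
    by apply: le_trans (ler_norm _) _; rewrite normrM ler_wpM2l.
  lra.
have M0 : 0 < M + 1.
  by rewrite ltr_wpDl// /M !addr_ge0.
move=> r; apply/cvgrPdist_le => eps eps0.
have e0 : 0 < eps / (M + 1) / 2 by rewrite !divr_gt0.
near=> r'.
have p_near : `|p r - p r'| <= eps / (M + 1) / 2.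
  by near: r'; move/cvgrPdist_le: (p_cont r); apply.
have q_near : `|q r - q r'| <= eps / (M + 1) / 2.
  by near: r'; move/cvgrPdist_le: (q_cont r); apply.
have sum_le : `|p r - p r'| + `|q r - q r'| <= eps / (M + 1) by lra.
have : M * (`|p r - p r'| + `|q r - q r'|) <= eps.
  apply: (@le_trans _ _ ((M + 1) * (`|p r - p r'| + `|q r - q r'|))).
    by rewrite ler_wpM2r ?addr_ge0// lerDl.
  by rewrite mulrC -ler_pdivlMr.
have := D_diff (p r) (q r) (p r') (q r').
have := D_diff (p r') (q r') (p r) (q r).
rewrite (distrC (p r')) (distrC (q r')) ler_norml => *.
by apply/andP; split; lra.
Unshelve. all: by end_near. Qed.

(* Walk in the dual plane from [f] to [-f] through [g], keeping the norm equal
   to that of [f]: the norm of the sum with [f] drops from [2 |f|] to [0]. *)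
Lemma exists_three_functionals : exists phi : 'I_3 -> X -> R,
  [/\ forall i, scalar (phi i), forall v, \sum_i phi i v = 0,
      forall i v, phi i v <= `|v| &
      forall i, exists2 x, `|x| = 1 & phi i x = 1].
Proof.
have [c [b [c_lin _ cb]]] := has_dim_basis dimX.
pose f := c (Ordinal d0); pose g := c (Ordinal d2).
have f_lin : scalar f by exact: c_lin.
have g_lin : scalar g by exact: c_lin.
have [D [D_le D_attained]] := exists_dual_norm f_lin g_lin.
have D_cont := dual_norm_continuous f_lin g_lin D_le D_attained.
have D_pos s t : (s != 0) || (t != 0) -> 0 < D s t.
  move=> st; pose x := s *: b (Ordinal d0) + t *: b (Ordinal d2).
  have := D_le s t x.
  have fx : f x = s.
    rewrite /x (scalarfD f_lin) !(scalarfZ f_lin) /f !cb eqxx.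
    by rewrite mulr1 mulr0 addr0.
  have gx : g x = t.
    rewrite /x (scalarfD g_lin) !(scalarfZ g_lin) /g !cb eqxx.
    by rewrite mulr1 mulr0 add0r.
  rewrite fx gx => le_x; have : 0 < D s t * `|x|.
    apply: lt_le_trans le_x; rewrite -!expr2.
    by case/orP: st => [s0|t0]; [rewrite ltr_pwDl|rewrite ltr_wpDl];
      rewrite ?sqr_ge0// lt_neqAle sqr_ge0 eq_sym sqrf_eq0 ?s0 ?t0.
  have [->|x0] := eqVneq x 0; first by rewrite normr0 mulr0 ltxx.
  by rewrite pmulr_lgt0// normr_gt0.
have D_hom r s t : 0 <= r -> D (r * s) (r * t) = r * D s t.
  move=> r0; apply/eqP; rewrite eq_le; apply/andP; split.
    have [x x1 <-] := D_attained (r * s) (r * t).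
    have := D_le s t x; rewrite x1 mulr1 => /(ler_wpM2l r0).
    by apply: le_trans; rewrite le_eqVlt; apply/orP; left; apply/eqP; ring.
  have [x x1 <-] := D_attained s t.
  have := D_le (r * s) (r * t) x; rewrite x1 mulr1.
  by apply: le_trans; rewrite le_eqVlt; apply/orP; left; apply/eqP; ring.
have D_opp_le s t : D (- s) (- t) <= D s t.
  have [x x1 <-] := D_attained (- s) (- t).
  have := D_le s t (- x); rewrite normrN x1 mulr1 (scalarfN f_lin) (scalarfN g_lin).
  by apply: le_trans; rewrite le_eqVlt; apply/orP; left; apply/eqP; ring.
have D_opp s t : D (- s) (- t) = D s t.
  apply/eqP; rewrite eq_le D_opp_le /=.
  by have := D_opp_le (- s) (- t); rewrite !opprK.
have m0 : 0 < D 1 0 by apply: D_pos; rewrite oner_eq0.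
(* The curve is [- r f + (1 - r^2) g] for [r] from -1 to 1, and [L r] is its norm. Up to the
   positive factor [m * L r], [h r] is the norm of the sum of the normalised [f] and the normalised
   curve point, minus 1. *)
pose m := D 1 0; pose L r := D (- r) (1 - r ^+ 2).
pose h r := D (L r + m * - r) (m * (1 - r ^+ 2)) - m * L r.
have cont_id : continuous (fun r : R => - r) by move=> r; exact: oppr_continuous.
have cont_sq : continuous (fun r : R => 1 - r ^+ 2).
  move=> r; apply: cvgB; first exact: cvg_cst.
  exact: exprn_continuous.
have L_cont : continuous L by apply: D_cont.
have h_cont : continuous h.
  move=> r; apply: cvgB.
    apply: (D_cont (fun r => L r + m * - r) (fun r => m * (1 - r ^+ 2))) => r'.
      by apply: cvgD; [exact: L_cont|apply: cvgMr; exact: cont_id].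
    by apply: cvgMr; exact: cont_sq.
  by apply: cvgMr; exact: L_cont.
have L1 : L 1 = m by rewrite /L expr1n subrr /m -(D_opp 1 0) oppr0.
have LN1 : L (-1) = m by rewrite /L sqrrN expr1n subrr opprK.
have hN1 : 0 <= h (-1).
  rewrite /h LN1 sqrrN expr1n subrr opprK mulr0 mulr1.
  have -> : D (m + m) 0 = 2 * m * D 1 0.
    rewrite -D_hom ?mulr1 ?mulr0; last by rewrite mulr_ge0// ltW.
    by congr D; ring.
  by rewrite -/m subr_ge0 ler_pM2r// mulrC mulr_natr mulr2n lerDl ltW.
have h1 : h 1 <= 0.
  rewrite /h L1 expr1n subrr mulr0 mulrN mulr1 subrr.
  have -> : D 0 0 = 0 by have := D_hom 0 0 0 (lexx 0); rewrite !mul0r.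
  by rewrite sub0r oppr_le0 mulr_ge0// ltW.
have [r _ hr] : exists2 r, r \in `[(-1), 1]%R & h r = 0.
  apply: IVT; first by lra.
    by apply: continuous_subspaceT.
  by rewrite ge_min le_max h1 hN1 orbT.
have L0 : 0 < L r.
  apply: D_pos; rewrite oppr_eq0; have [->|//] := eqVneq r 0.
  by rewrite expr0n /= subr0 oner_eq0.
(* Coefficients on [f] and [g] of the normalised [f], of the normalised curve point, and of minus
   their sum, which has norm 1 because [h r = 0]. *)
pose al := [tuple m^-1; - r / L r; - (m^-1 - r / L r)].
pose be := [tuple 0; (1 - r ^+ 2) / L r; - ((1 - r ^+ 2) / L r)].
pose phi (i : 'I_3) v := tnth al i * f v + tnth be i * g v.
have D1 i : D (tnth al i) (tnth be i) = 1.
  case: i => -[|[|[|//]]] i3; rewrite !(tnth_nth 0) /=.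
  - have -> : D m^-1 0 = D (m^-1 * 1) (m^-1 * 0) by rewrite mulr1 mulr0.
    by rewrite D_hom ?invr_ge0 ?ltW// -/m mulVf// gt_eqF.
  - rewrite [X in D X _]mulrC [X in D _ X]mulrC D_hom ?invr_ge0 ?ltW//.
    by rewrite mulVf// gt_eqF.
  - have mL0 : 0 < (m * L r)^-1 by rewrite invr_gt0 mulr_gt0.
    have mL_neq0 : m * L r != 0 by rewrite lt0r_neq0// mulr_gt0.
    have DmL : D (L r + m * - r) (m * (1 - r ^+ 2)) = m * L r.
      by apply/eqP; rewrite -subr_eq0; apply/eqP.
    rewrite D_opp; transitivity ((m * L r)^-1 * D (L r + m * - r) (m * (1 - r ^+ 2))).
      by rewrite -D_hom ?ltW//; congr (D _ _); field; rewrite ?lt0r_neq0.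
    by rewrite DmL mulVf.
exists phi; split=> [i|v|i v|i].
- by move=> a x y /=; rewrite /phi f_lin g_lin /=; ring.
- by rewrite /phi !big_ord_recl big_ord0 !(tnth_nth 0) /=; ring.
- by have := D_le (tnth al i) (tnth be i) v; rewrite D1 mul1r.
- by have [x x1 xE] := D_attained (tnth al i) (tnth be i); exists x; rewrite // -(D1 i).
Qed.

(** As the three functionals add up to 0, the sum of two is the opposite of the third, so all subset
    sums have dual norm at most 1. *)
Lemma steiner_degree3 : steiner_degrees X 3.
Proof.
have [phi [phi_lin phi0 phi_le norming]] := exists_three_functionals.
have exa i : exists x : X, `|x| = 1 /\ phi i x = 1.
  by have [x] := norming i; exists x.
have [a aP] := choice exa.
apply: (@star_steiner_degree _ _ _ a phi) => // [I v|i|i]; try by have [] := aP i.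
have phi_ge i : - `|v| <= phi i v.
  by rewrite -normrN lerNl -(scalarfN (phi_lin i)) phi_le.
rewrite big_mkcond /=; have := phi0 v; rewrite !big_ord_recl !big_ord0 /=.
move: (phi_le ord0 v) (phi_ge ord0).
move: (phi_le (lift ord0 ord0) v) (phi_ge (lift ord0 ord0)).
move: (phi_le (lift ord0 (lift ord0 ord0)) v) (phi_ge (lift ord0 (lift ord0 ord0))).
have := normr_ge0 v.
case: (ord0 \in I); case: (lift ord0 ord0 \in I);
  case: (lift ord0 (lift ord0 ord0) \in I) => /= *; lra.
Qed.

End ThreeFunctionals.

Lemma smooth_steiner_degrees (R : realType) (X : completeNormedModType R) (d : nat) :
  (2 <= d)%N -> has_dim d X -> smooth X -> exists s v : nat,
  [/\ is_s X s, is_v X v, (3 <= s)%N, (s <= v)%N & (v <= d.+1)%N].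
Proof.
move=> d2 dimX smX.
have v_le n : vertex_degrees X n -> (n <= d.+1)%N by exact: vertex_degree_le.
have s_le n : steiner_degrees X n -> (n <= d.+1)%N by move=> /steiner_degree_vertex/v_le.
have [s s_max s3] := exists_largest (steiner_degree3 d2 dimX) s_le.
have [v v_max sv] := exists_largest (steiner_degree_vertex s_max.1) v_le.
by exists s, v; split=> //; apply: v_le; exact: v_max.1.
Qed.

(** * Norms on row vectors *)

(** Domination of the coordinates gives definiteness, and it makes Cauchy filters Cauchy for the sup
    norm. *)
Record rVnorm (R : realType) (d : nat) := RVNorm {
  rvn :> 'rV[R]_d -> R;
  rvnD : forall x y, rvn (x + y) <= rvn x + rvn y;
  rvnZ : forall a x, rvn (a *: x) = `|a| * rvn x;
  rvn_coord : forall (x : 'rV[R]_d) i, `|x 0 i| <= rvn x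
}.

(** An alias indexed by [N], to keep its norm apart from the sup norm that ['rV[R]_d] already
    carries. *)
Definition normed_rV (R : realType) (d : nat) (N : rVnorm R d) : Type := 'rV[R]_d.

Section NormedRV.
Context (R : realType) (d : nat) (N : rVnorm R d).

HB.instance Definition _ := GRing.Lmodule.copy (normed_rV N) 'rV[R]_d.

Let rvn_eq0 (x : normed_rV N) : N x = 0 -> x = 0.
Proof.
move=> Nx0; apply/rowP => i; rewrite mxE; apply/eqP.
by rewrite -normr_le0 -Nx0 rvn_coord.
Qed.

HB.instance Definition _ := Lmodule_isNormed.Build R (normed_rV N)
  (@rvnD _ _ N) (@rvnZ _ _ N) rvn_eq0.

Lemma normed_rVE (x : normed_rV N) : `|x| = N x.
Proof. by []. Qed.

Let rvn_le (x : 'rV[R]_d) : N x <= (\sum_i N (delta_mx 0 i)) * `|x|.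
Proof.
have N0 : N 0 = 0 by have := rvnZ N 0 0; rewrite scale0r normr0 mul0r.
rewrite {1}[x]row_sum_delta mulr_suml.
have N_sum (s : seq 'I_d) (F : 'I_d -> 'rV[R]_d) :
    N (\sum_(i <- s) F i) <= \sum_(i <- s) N (F i).
  elim: s => [|i s IHs]; first by rewrite !big_nil N0.
  by rewrite !big_cons (le_trans (rvnD _ _ _))// lerD2l.
apply: le_trans (N_sum _ _) _; apply: ler_sum => i _.
rewrite rvnZ mulrC ler_wpM2l//; last first.
  rewrite -[leRHS]/(mx_norm x) mx_normrE; apply/bigmax_geP; right => /=.
  by exists (0, i).
by apply: le_trans (rvn_coord _ _ i).
Qed.

Let normed_rV_complete (F : set_system (normed_rV N)) :
  ProperFilter F -> cauchy F -> cvg F.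
Proof.
move=> FF /cauchy_ballP F_cauchy.
have : cauchy (F : set_system 'rV[R]_d).
  apply/cauchy_ballP => e e0; apply: filterS (F_cauchy e e0) => -[x y] /= xy.
  split=> // i j; rewrite (ord1 i).
  have {}xy : N (x - y) < e by move: xy; rewrite -ball_normE.
  rewrite -ball_normE; apply: le_lt_trans xy.
  by have := rvn_coord N (x - y) j; rewrite !mxE.
move=> /(@cauchy_cvg _ F FF) /cvg_ex [l Fl].
apply/cvg_ex; exists (l : normed_rV N); apply/cvgrPdist_le => e e0.
pose C := \sum_i N (delta_mx 0 i) + 1.
have C0 : 0 < C.
  rewrite /C ltr_wpDl// sumr_ge0// => i _.
  by apply: le_trans (rvn_coord _ _ i).
have eC : 0 < e / C by rewrite divr_gt0.
move/cvgrPdist_le: Fl => /(_ _ eC); apply: filterS => y ly.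
rewrite normed_rVE; apply: le_trans (rvn_le _) _.
apply: (@le_trans _ _ (C * `|l - y : 'rV[R]_d|)); first by rewrite ler_wpM2r// lerDl.
by rewrite mulrC -ler_pdivlMr.
Qed.

HB.instance Definition _ := Uniform_isComplete.Build (normed_rV N) normed_rV_complete.

Lemma has_dim_normed_rV : has_dim d (normed_rV N : completeNormedModType R).
Proof. by constructor; exists id => //; exists id. Qed.

End NormedRV.

(** * Power norms *)

(** Only convexity of the square is iterated, which is why the exponents are powers of two. *)
Lemma exprn_2pow_convex (R : realFieldType) (m : nat) (a b s t : R) :
  0 <= a -> 0 <= b -> a + b = 1 ->
  (a * s + b * t) ^+ (2 ^ m) <= a * s ^+ (2 ^ m) + b * t ^+ (2 ^ m).
Proof.
move=> a0 b0 ab; elim: m s t => [|m IHm] s t; first by rewrite expn0 !expr1.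
rewrite expnS !exprM; apply: le_trans (IHm (s ^+ 2) (t ^+ 2)).
apply: lerXn2r; rewrite ?nnegrE ?sqr_ge0//.
  by apply: addr_ge0; apply: mulr_ge0; rewrite ?sqr_ge0.
rewrite -subr_ge0; have -> : b = 1 - a by lra.
have -> : a * s ^+ 2 + (1 - a) * t ^+ 2 - (a * s + (1 - a) * t) ^+ 2 =
  a * (1 - a) * (s - t) ^+ 2 by ring.
by rewrite mulr_ge0 ?sqr_ge0// mulr_ge0//; lra.
Qed.

Section PowerNorm.
Context (R : realType) (d m : nat) (K : finType) (w : K -> R).
Context (f : K -> 'rV[R]_d -> R).
Hypothesis m_gt0 : (0 < m)%N.
Hypothesis w_ge0 : forall k, 0 <= w k.
Hypothesis f_lin : forall k, scalar (f k).
Hypothesis f_coord : forall i : 'I_d,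
  exists2 k, 1 <= w k & forall x : 'rV[R]_d, f k x = x 0 i.

Let p := (2 ^ m)%N.

Let p_gt0 : (0 < p)%N. Proof. by rewrite expn_gt0. Qed.

Let p_even : ~~ odd p. Proof. by rewrite /p oddX orbF -lt0n. Qed.

Definition power_sum (x : 'rV[R]_d) : R := \sum_k w k * f k x ^+ p.

(** The weighted [l^p] norm of the family [f k x]; as [p] is even, no absolute values occur. *)
Definition power_norm (x : 'rV[R]_d) : R := power_sum x `^ (p%:R^-1).

Let term_ge0 k x : 0 <= w k * f k x ^+ p.
Proof. by rewrite mulr_ge0// exprn_even_ge0. Qed.

Lemma power_sum_ge0 x : 0 <= power_sum x.
Proof. by rewrite sumr_ge0. Qed.

Lemma power_norm_ge0 x : 0 <= power_norm x.
Proof. exact: powR_ge0. Qed.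

Lemma power_norm_exp x : power_norm x ^+ p = power_sum x.
Proof.
rewrite /power_norm -powR_mulrn ?powR_ge0// -powRrM mulVf ?pnatr_eq0 -?lt0n//.
by rewrite powRr1// power_sum_ge0.
Qed.

Lemma power_norm_le x b : 0 <= b -> (power_norm x <= b) = (power_sum x <= b ^+ p).
Proof.
move=> b0; rewrite -power_norm_exp ler_pXn2r// nnegrE//.
exact: power_norm_ge0.
Qed.

Lemma power_norm_term k x : w k * f k x ^+ p <= power_norm x ^+ p.
Proof. by rewrite power_norm_exp /power_sum (bigD1 k)//= lerDl sumr_ge0. Qed.

Lemma power_norm_coord (x : 'rV[R]_d) i : `|x 0 i| <= power_norm x.
Proof.
have [k wk fk] := f_coord i.
rewrite -(@ler_pXn2r _ p)// ?nnegrE ?power_norm_ge0//.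
apply: le_trans (power_norm_term k x).
by rewrite -normrX ger0_norm ?exprn_even_ge0// fk ler_peMl// exprn_even_ge0.
Qed.

Lemma power_normZ a x : power_norm (a *: x) = `|a| * power_norm x.
Proof.
apply: (@pexpIrn _ p) => //; rewrite ?nnegrE ?mulr_ge0 ?power_norm_ge0//.
rewrite exprMn !power_norm_exp /power_sum mulr_sumr; apply: eq_bigr => k _.
rewrite (scalarfZ (f_lin k)) exprMn -normrX ger0_norm ?exprn_even_ge0//.
by rewrite mulrCA.
Qed.

Lemma power_norm_eq0 x : power_norm x = 0 -> x = 0.
Proof.
move=> x0; apply/rowP => i; rewrite mxE; apply/eqP.
by rewrite -normr_le0 -x0 power_norm_coord.
Qed.

(** Minkowski's inequality: [x + y] is [a + b] times a convex combination of the unit vectors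
    [x / a] and [y / b], and convexity of the power is applied term by term. *)
Lemma power_normD x y : power_norm (x + y) <= power_norm x + power_norm y.
Proof.
have [/power_norm_eq0->|x0] := eqVneq (power_norm x) 0.
  by rewrite add0r lerDr power_norm_ge0.
have [/power_norm_eq0->|y0] := eqVneq (power_norm y) 0.
  by rewrite addr0 lerDl power_norm_ge0.
have a0 : 0 < power_norm x by rewrite lt_neqAle eq_sym x0 power_norm_ge0.
have b0 : 0 < power_norm y by rewrite lt_neqAle eq_sym y0 power_norm_ge0.
set a := power_norm x in a0 x0 *; set b := power_norm y in b0 y0 *.
have ab0 : 0 < a + b by rewrite addr_gt0.
have ab_neq0 : a + b != 0 by rewrite lt0r_neq0.
rewrite power_norm_le; last exact: ltW.
have -> : (a + b) ^+ p =
    \sum_k w k * ((a + b) ^+ p * (a / (a + b) * (f k x / a) ^+ p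
      + b / (a + b) * (f k y / b) ^+ p)).
  have := power_norm_exp x; have := power_norm_exp y; rewrite -/a -/b => Py Px.
  have norm1 z c : c != 0 -> c ^+ p = power_sum z -> \sum_k w k * (f k z / c) ^+ p = 1.
    move=> c0 cE; under eq_bigr do rewrite expr_div_n mulrA.
    by rewrite -mulr_suml -/(power_sum z) -cE divff// expf_neq0.
  transitivity ((a + b) ^+ p * (a / (a + b) * \sum_k w k * (f k x / a) ^+ p +
      b / (a + b) * \sum_k w k * (f k y / b) ^+ p)).
    by rewrite !norm1// !mulr1 -mulrDl divff// mulr1.
  rewrite !mulr_sumr -big_split /= mulr_sumr; apply: eq_bigr => k _.
  by ring.
rewrite {1}/power_sum; apply: ler_sum => k _; rewrite ler_wpM2l//.
have -> : f k (x + y) = (a + b) * (a / (a + b) * (f k x / a) + b / (a + b) * (f k y / b)).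
  by rewrite (scalarfD (f_lin k)); field; rewrite x0 y0 ab_neq0.
rewrite exprMn ler_pM2l ?exprn_gt0//.
apply: exprn_2pow_convex; rewrite ?divr_ge0 ?ltW//.
by rewrite -mulrDl divff.
Qed.

Definition power_rVnorm : rVnorm R d :=
  RVNorm power_normD power_normZ power_norm_coord.

(** Along a line through [x] the power sum is a polynomial in [t], positive at [t = 0], where the
    [p]-th root is therefore differentiable. *)
Lemma smooth_power_norm : smooth (normed_rV power_rVnorm : completeNormedModType R).
Proof.
move=> x h x0; apply/derivable1P.
have -> : (fun t : R => `|t *: h + x| : R^o) =
    (fun s => s `^ p%:R^-1) \o
    (fun t => \sum_k w k * (t * f k h + f k x) ^+ p).
  apply/funext => t /=; rewrite normed_rVE /= /power_norm /power_sum.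
  congr (_ `^ _); apply: eq_bigr => k _; rewrite f_lin //.
have aff_der (a b : R) n : derivable (fun t : R => (t * a + b) ^+ n : R) 0 1.
  elim: n => [|n IHn].
    have -> : (fun t : R => (t * a + b) ^+ 0 : R) = cst 1.
      by apply/funext => t; rewrite expr0.
    exact: derivable_cst.
  have -> : (fun t : R => (t * a + b) ^+ n.+1 : R) =
      (fun t => t * a + b) * (fun t => (t * a + b) ^+ n).
    by apply/funext => t; rewrite exprS.
  have lin_der : derivable (fun t : R => t * a + b : R) 0 1.
    have -> : (fun t : R => t * a + b : R) = id * cst a + cst b by exact/funext.
    apply: derivableD; last exact: derivable_cst.
    by apply: derivableM; [exact: derivable_id|exact: derivable_cst].
  exact: derivableM lin_der IHn.
have P_der (s : seq K) : derivable
    (fun t : R => \sum_(k <- s) w k * (t * f k h + f k x) ^+ p : R) 0 1.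
  elim: s => [|k s IHs].
    have -> : (fun t : R => \sum_(k <- [::]) w k * (t * f k h + f k x) ^+ p : R) = cst 0.
      by apply/funext => t; rewrite big_nil.
    exact: derivable_cst.
  have -> : (fun t : R => \sum_(l <- k :: s) w l * (t * f l h + f l x) ^+ p : R) =
      cst (w k) * (fun t => (t * f k h + f k x) ^+ p) +
      (fun t => \sum_(l <- s) w l * (t * f l h + f l x) ^+ p).
    by apply/funext => t; rewrite big_cons.
  apply: derivableD IHs; apply: derivableM (aff_der _ _ _).
  exact: derivable_cst.
apply/derivable1_diffP/differentiable_comp; first exact/derivable1_diffP.
apply/derivable1_diffP.
have P0 : 0 < \sum_k w k * (0 * f k h + f k x) ^+ p.
  under eq_bigr do rewrite mul0r add0r.
  rewrite -/(power_sum x) -power_norm_exp exprn_gt0// lt_neqAle power_norm_ge0 andbT.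
  by rewrite eq_sym; apply: contra_neq x0; exact: power_norm_eq0.
by have [] := is_derive1_powR p%:R^-1 P0.
Qed.

End PowerNorm.

(** * Euclidean space *)

Lemma scalar_coord (R : realType) (d : nat) (i : 'I_d) :
  scalar (fun x : 'rV[R]_d => x 0 i).
Proof. by move=> a x y; rewrite !mxE. Qed.

Section Euclidean.
Context (R : realType) (d : nat).

Let ones_ge0 (k : 'I_d) : 0 <= (1 : R). Proof. exact: ler01. Qed.

Let coord_mem (i : 'I_d) :
  exists2 k : 'I_d, 1 <= (1 : R) & forall x : 'rV[R]_d, x 0 k = x 0 i.
Proof. by exists i. Qed.

Definition euclidean_norm : rVnorm R d :=
  power_rVnorm (m := 1) (w := fun=> 1) isT ones_ge0 (@scalar_coord R d) coord_mem.

Local Notation E := (normed_rV euclidean_norm : completeNormedModType R).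

Lemma smooth_euclidean : smooth E.
Proof. exact: smooth_power_norm. Qed.

Definition dot (x y : 'rV[R]_d) : R := \sum_i x 0 i * y 0 i.

Lemma dotC x y : dot x y = dot y x.
Proof. by apply: eq_bigr => i _; rewrite mulrC. Qed.

Lemma dot_scalar x : scalar (dot x).
Proof.
move=> a y z; rewrite /dot mulr_sumr -big_split /=; apply: eq_bigr => i _.
by rewrite !mxE; ring.
Qed.

Lemma dot_self (x : E) : dot x x = `|x| ^+ 2.
Proof.
rewrite normed_rVE /= -[2%N]/(2 ^ 1)%N power_norm_exp// /power_sum.
by apply: eq_bigr => i _; rewrite mul1r expr2.
Qed.

Lemma dot_le (x y : E) : dot x y <= `|x| * `|y|.
Proof.
have [->|x0] := eqVneq x 0.
  by rewrite normr0 mul0r dotC (scalarf0 (dot_scalar y)).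
have [->|y0] := eqVneq y 0.
  by rewrite normr0 mulr0 (scalarf0 (dot_scalar x)).
have xy0 : 0 < `|x| * `|y| by rewrite mulr_gt0 ?normr_gt0.
(* Cauchy-Schwarz, by expanding this square. *)
have := sqr_ge0 (`|(`|y| *: x - `|x| *: y : E)|); rewrite -dot_self.
rewrite (scalarfB (dot_scalar _)) !(scalarfZ (dot_scalar _)).
rewrite dotC [X in _ - _ * X]dotC !(scalarfB (dot_scalar _)) !(scalarfZ (dot_scalar _)).
rewrite !dot_self (dotC y x) => ge0.
rewrite -(ler_pM2l xy0); lra.
Qed.

Lemma euclidean_dnorm (u : E) : u != 0 -> dnorm u = (fun v => dot (`|u|^-1 *: u) v).
Proof.
move=> u0; have u_gt0 : 0 < `|u| by rewrite normr_gt0.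
apply/esym/(dnorm_norming smooth_euclidean u0).
- exact: dot_scalar.
- move=> v; rewrite dotC (scalarfZ (dot_scalar _)) mulrC ler_pdivrMr//.
  exact: dot_le.
- by rewrite dotC (scalarfZ (dot_scalar _)) dot_self expr2 mulrA mulVf ?mul1r// lt0r_neq0.
Qed.

(* Unit vectors with pairwise sums of norm at most 1 have pairwise inner products
   at most -1/2, and the square of the norm of their sum is nonnegative. *)
Lemma euclidean_degree_le n : vertex_degrees E n -> (n <= 3)%N.
Proof.
move=> [S [T [x [T_smt _ <-]]]].
have [u u0 u_le] := smt_functionals x smooth_euclidean T_smt.
set k := degree x in u u0 u_le *.
pose e i : E := `|u i|^-1 *: u i.
have e1 i : dot (e i) (e i) = 1.
  rewrite dot_self normrZ ger0_norm ?invr_ge0// mulVf ?expr1n//.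
  by rewrite normr_eq0.
have eij i j : i != j -> dot (e i) (e j) <= - 2^-1.
  (* Tested at [e i + e j] itself, the bound for the pair says that the square of the norm of this
     sum is at most the norm. *)
  move=> ij; have := u_le [set i; j]%SET (e i + e j).
  rewrite big_setU1 ?inE//= big_set1 !euclidean_dnorm// -!/(e _).
  have N2 : `|e i + e j| ^+ 2 = dot (e i) (e i + e j) + dot (e j) (e i + e j).
    rewrite -dot_self dotC (scalarfD (dot_scalar _)).
    by rewrite dotC [X in _ + X]dotC.
  rewrite -N2 => N_le; have N1 : `|e i + e j| ^+ 2 <= 1.
    have : `|e i + e j| * `|e i + e j| <= 1 * `|e i + e j| by rewrite mul1r -expr2.
    have [->|N0] := eqVneq (`|e i + e j|) 0; first by rewrite expr0n.
    rewrite ler_pM2r ?lt_neqAle 1?eq_sym ?N0//= => N1.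
    by rewrite expr_le1.
  move: N1; rewrite N2 !(scalarfD (dot_scalar _)) !e1 (dotC (e j) (e i)); lra.
have := sqr_ge0 `|\sum_i e i|; rewrite -dot_self.
have dot_sum v : dot v (\sum_i e i) = \sum_i dot v (e i).
  exact: (big_morph _ (scalarfD (dot_scalar v)) (scalarf0 (dot_scalar v))).
rewrite dot_sum; under eq_bigr do rewrite dotC dot_sum.
(* The row sums of the Gram matrix are negative as soon as [k] is at least 4. *)
have row_le i : \sum_j dot (e i) (e j) <= 1 - (k%:R - 1) / 2.
  rewrite (bigD1 i)//= e1 lerD2l.
  apply: (@le_trans _ _ (\sum_(j | j != i) - 2^-1)).
    by apply: ler_sum => j ji; apply: eij; rewrite eq_sym.
  have k_gt0 : (0 < k)%N by exact: leq_ltn_trans (ltn_ord i).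
  by rewrite sumr_const cardC1 card_ord -[_ *+ _]mulr_natr -subn1 natrB//; lra.
move=> sum_ge0; have : 0 <= k%:R * (1 - (k%:R - 1) / 2 : R).
  apply: le_trans sum_ge0 _; apply: le_trans (ler_sum _ (fun i _ => row_le i)) _.
  by rewrite sumr_const card_ord mulr_natl.
rewrite leqNgt => k_ge0; apply/negP => k4.
have : (4 : R) <= k%:R by rewrite ler_nat.
move=> k4R; move: k_ge0; rewrite pmulr_rge0; last by lra.
lra.
Qed.

End Euclidean.

Lemma exists_smooth_s3 (R : realType) (d : nat) : (2 <= d)%N ->
  exists X : completeNormedModType R, [/\ has_dim d X, smooth X & is_s X 3].
Proof.
move=> d2; exists (normed_rV (euclidean_norm R d)); split.
- exact: has_dim_normed_rV.
- exact: smooth_euclidean.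
have s3 := @steiner_degree3 R _ d d2 (has_dim_normed_rV (euclidean_norm R d)).
by split=> // n /steiner_degree_vertex; exact: euclidean_degree_le.
Qed.

(** * A space with a vertex of degree d + 1 *)

Section SimplexNorm.
Context (R : realType) (d : nat).
Hypothesis d2 : (2 <= d)%N.

(* [x |-> (simplex_coord i x)_i] identifies ['rV_d] with the hyperplane of sum zero in
   dimension [d + 1]. *)
Definition simplex_coord (i : 'I_d.+1) (x : 'rV[R]_d) : R :=
  if unlift ord0 i is Some j then x 0 j else - \sum_j x 0 j.

Local Notation g := simplex_coord.

Definition subset_sum (I : {set 'I_d.+1}) (x : 'rV[R]_d) : R := \sum_(i in I) g i x.

Lemma simplex_coord0 x : g ord0 x = - \sum_j x 0 j.
Proof. by rewrite /g unlift_none. Qed.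

Lemma simplex_coord_lift j x : g (lift ord0 j) x = x 0 j.
Proof. by rewrite /g liftK. Qed.

Lemma simplex_coord_scalar i : scalar (g i).
Proof.
move=> a x y; rewrite /g; case: unliftP => [j _|_]; first by rewrite !mxE.
under eq_bigr do rewrite !mxE.
by rewrite big_split /= -mulr_sumr; ring.
Qed.

Lemma sum_simplex_coord x : \sum_i g i x = 0.
Proof.
rewrite big_ord_recl simplex_coord0.
by rewrite (eq_bigr _ (fun j _ => simplex_coord_lift j x)) addNr.
Qed.

Lemma subset_sum_scalar I : scalar (subset_sum I).
Proof.
move=> a x y; rewrite /subset_sum mulr_sumr -big_split /=; apply: eq_bigr => i _.
exact: simplex_coord_scalar.
Qed.

Lemma subset_sumC I x : subset_sum (~: I)%SET x = - subset_sum I x.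
Proof.
apply/eqP; rewrite -addr_eq0 addrC -(sum_simplex_coord x) [eqbRHS](bigID (mem I)) /=.
rewrite /subset_sum; apply/eqP; congr (_ + _); apply: eq_bigl => i.
by rewrite inE.
Qed.

Lemma subset_sum1 i x : subset_sum [set i]%SET x = g i x.
Proof. by rewrite /subset_sum big_set1. Qed.

(* The heavy weight [W] makes the middle subset sums small on the unit ball, while
   its effect at [test] is killed by the large exponent. *)
Let W : R := #|{: {set 'I_d.+1}}|%:R.

Let W1 : 1 <= W.
Proof. by rewrite ler1n; apply/card_gt0P; exists finset.set0. Qed.

(** The other sets are, up to complement, empty or singletons, so their sums are 0 or a coordinate
    up to sign. *)
Definition middle (I : {set 'I_d.+1}) := (1 < #|I| < d)%N.

Definition weight (I : {set 'I_d.+1}) : R := if middle I then W else 1.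

Let weight_ge0 I : 0 <= weight I.
Proof. by rewrite /weight; case: ifP => _ //; apply: le_trans W1. Qed.

Let d0 : 0 < d%:R :> R. Proof. by rewrite ltr0n (leq_trans _ d2). Qed.

(** In the hyperplane this is the vector with coordinates 1, -1/d, ..., -1/d. *)
Definition test : 'rV[R]_d := const_mx (- d%:R^-1).

Let test0 : g ord0 test = 1.
Proof.
rewrite simplex_coord0; under eq_bigr do rewrite mxE.
by rewrite sumr_const card_ord mulNrn opprK -[_^-1 *+ _]mulr_natr mulVf// lt0r_neq0.
Qed.

Let subset_sum_test_notin (I : {set 'I_d.+1}) :
  ord0 \notin I -> subset_sum I test = - (#|I|%:R / d%:R).
Proof.
move=> I0; rewrite /subset_sum (eq_bigr (fun=> - d%:R^-1)) => [|i iI].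
  by rewrite sumr_const mulNrn -[_^-1 *+ _]mulr_natl.
have : i != ord0 by apply: contraNneq I0 => <-.
case: (unliftP ord0 i) => [j -> _|->]; last by rewrite eqxx.
by rewrite simplex_coord_lift mxE.
Qed.

Let card_notin0 (I : {set 'I_d.+1}) : ord0 \notin I -> (#|I| <= d)%N.
Proof.
move=> I0; suff : (#|I| < #|[set: 'I_d.+1]%SET|)%N by rewrite cardsT card_ord.
apply: proper_card.
apply/fintype.properP; split; first exact: finset.subsetT.
by exists ord0; rewrite ?inE.
Qed.

(** Complementation only changes the sign of the sum and preserves [middle], so [I] may be assumed
    to avoid [ord0]. *)
Let subset_sum_test (I : {set 'I_d.+1}) : `|subset_sum I test| <= 1 /\
  (middle I -> `|subset_sum I test| <= (d.-1)%:R / d%:R).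
Proof.
wlog I0 : I / ord0 \notin I => [wlogI|].
  have [I0|] := boolP (ord0 \in I); last exact: wlogI.
  have := wlogI (~: I)%SET; rewrite inE I0 subset_sumC normrN => /(_ isT)[le1 le_mid].
  split=> // mid; apply: le_mid; move: mid; rewrite /middle.
  by have := cardsC I; rewrite card_ord; lia.
rewrite subset_sum_test_notin// normrN ger0_norm ?divr_ge0//; split.
  by rewrite ler_pdivrMr// mul1r ler_nat card_notin0.
move=> /andP[_ Id]; rewrite ler_pM2r ?invr_gt0// ler_nat.
by rewrite -ltnS prednK// (leq_trans _ d2).
Qed.

Let exists_exponent : exists2 m, (0 < m)%N & W * ((d.-1)%:R / d%:R) ^+ (2 ^ m) <= 1.
Proof.
set r : R := _ / _.
have r0 : 0 <= r by rewrite divr_ge0.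
have r1 : r < 1 by rewrite ltr_pdivrMr// mul1r ltr_nat prednK// (leq_trans _ d2).
have W0 : 0 < W by apply: lt_le_trans W1.
have : (fun n => r ^+ n : R) @ \oo --> 0 by apply: cvg_expr; rewrite ger0_norm.
move=> /cvgrPdist_le /(_ W^-1); rewrite invr_gt0 => /(_ W0) [k _ /(_ k)/=].
rewrite leqnn sub0r normrN ger0_norm ?exprn_ge0// => /(_ isT) rk.
exists k.+1 => //; rewrite mulrC -ler_pdivlMr// mul1r; apply: le_trans rk.
apply: ler_wiXn2l => //; first exact: ltW.
by apply: leq_trans (ltnW (ltn_expl k.+1 (ltnSn 1))).
Qed.

Let coord_mem (j : 'I_d) : exists2 I, 1 <= weight I &
  forall x : 'rV[R]_d, subset_sum I x = x 0 j.
Proof.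
exists [set lift ord0 j]%SET => [|x]; last by rewrite subset_sum1 simplex_coord_lift.
by rewrite /weight; case: ifP.
Qed.

Section Exponent.
Context (m : nat).
Hypothesis m0 : (0 < m)%N.
Hypothesis m_large : W * ((d.-1)%:R / d%:R) ^+ (2 ^ m) <= 1.

Definition simplex_norm : rVnorm R d :=
  power_rVnorm m0 weight_ge0 subset_sum_scalar coord_mem.

Local Notation N := simplex_norm.

Let N_ge0 x : 0 <= N x. Proof. exact: power_norm_ge0. Qed.

(** Each of the [W] terms of the power sum is at most 1, the middle ones by the choice of the
    exponent. *)
Let N_test : N test ^+ (2 ^ m) <= W.
Proof.
rewrite /= power_norm_exp// /power_sum /W -sum1_card natr_sum; apply: ler_sum => I _.
have p_even : ~~ odd (2 ^ m) by rewrite oddX orbF -lt0n.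
rewrite -[subset_sum I test ^+ _]ger0_norm ?exprn_even_ge0// normrX.
have [le1 le_mid] := subset_sum_test I; rewrite /weight; case: ifP => mid.
  apply: le_trans m_large; rewrite ler_wpM2l ?(le_trans _ W1)//.
  by apply: lerXn2r; rewrite ?nnegrE ?divr_ge0// le_mid.
by rewrite mul1r exprn_ile1.
Qed.

(** A middle term carries the weight [W], which dominates the power of [N test]. *)
Let middle_le (I : {set 'I_d.+1}) x : middle I -> N test * subset_sum I x <= N x.
Proof.
move=> mid; apply: le_trans (ler_norm _) _.
rewrite -(@ler_pXn2r _ (2 ^ m)) ?nnegrE ?expn_gt0//.
have p_even : ~~ odd (2 ^ m) by rewrite oddX orbF -lt0n.
rewrite -normrX exprMn ger0_norm; last by rewrite mulr_ge0 ?exprn_even_ge0.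
apply: le_trans (@power_norm_term _ _ m _ weight subset_sum m0 weight_ge0 I x).
by rewrite /weight mid ler_wpM2r// exprn_even_ge0.
Qed.

(** The symmetric group acts on the [d + 1] hyperplane coordinates, hence not merely by permuting
    the entries of the row vector. *)
Let permute (s : {perm 'I_d.+1}) (x : 'rV[R]_d) : 'rV[R]_d :=
  \row_j g (s (lift ord0 j)) x.

Let permuteE s x i : g i (permute s x) = g (s i) x.
Proof.
case: (unliftP ord0 i) => [j|] ->; first by rewrite simplex_coord_lift mxE.
rewrite simplex_coord0; under eq_bigr do rewrite mxE.
have := sum_simplex_coord x; rewrite (reindex_inj (@perm_inj _ s)) /=.
by rewrite big_ord_recl => /eqP; rewrite addr_eq0 => /eqP.
Qed.

Let permute_norm s x : N (permute s x) = N x.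
Proof.
rewrite /= /power_norm; congr (_ `^ _); rewrite /power_sum.
rewrite [RHS](reindex_inj (imset_inj (@perm_inj _ s))) /=; apply: eq_bigr => I _.
have -> : weight (s @: I)%SET = weight I.
  by rewrite /weight /middle card_imset//; exact: perm_inj.
congr (_ * _ ^+ _); rewrite /subset_sum big_imset /=; last first.
  by move=> i j _ _; exact: perm_inj.
by apply: eq_bigr => i _; rewrite permuteE.
Qed.

(** By symmetry all coordinates have the same dual norm [c], attained at permuted copies of one
    vector [a]. These copies and the coordinates divided by [c] form a calibrated star. *)
Lemma simplex_vertex_degree :
  vertex_degrees (normed_rV N : completeNormedModType R) d.+1.
Proof.
have dimX := has_dim_normed_rV N.
have [a aN a_max] := exists_norming (leq_trans (ltn0Sn 1) d2) dimX (simplex_coord_scalar ord0).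
set c := g ord0 a in a_max.
(* Evaluation at [test] shows that [c] is at least the inverse of [N test], which bounds the dual
   norms of the middle sums. *)
have c_test : 1 <= c * N test by rewrite -test0; exact: a_max.
have c0 : 0 < c.
  rewrite ltNge; apply/negP => c_le0; move: c_test; rewrite leNgt => /negP; apply.
  by apply: (@le_lt_trans _ _ 0) => //; rewrite mulr_le0_ge0.
have g_le i x : g i x <= c * N x.
  have := a_max (permute (tperm ord0 i) x).
  by rewrite normed_rVE permute_norm permuteE tpermL.
have sum_le I x : subset_sum I x <= c * N x.
  have cN_ge0 : 0 <= c * N x by rewrite mulr_ge0// ltW.
  have [mid|] := boolP (middle I).
    have [neg|pos] := leP (subset_sum I x) 0; first exact: le_trans cN_ge0.
    apply: (@le_trans _ _ (c * N test * subset_sum I x)); first by rewrite ler_peMl// ltW.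
    by rewrite -mulrA ler_wpM2l ?middle_le// ltW.
  (* Outside the middle range, [I] or its complement has at most one element. *)
  have cardC := cardsC I; rewrite card_ord in cardC.
  rewrite /middle negb_and -!leqNgt => /orP[I1|Id].
    have [/eqP|] := posnP #|I|.
      by rewrite cards_eq0 => /eqP->; rewrite /subset_sum big_set0.
    move=> I_gt0; have /eqP/cards1P[i ->] : #|I| = 1%N by lia.
    by rewrite subset_sum1.
  rewrite -[I]finset.setCK subset_sumC.
  have [/eqP|] := posnP #|(~: I)%SET|.
    by rewrite cards_eq0 => /eqP->; rewrite /subset_sum big_set0 oppr0.
  move=> I_gt0; have /eqP/cards1P[i ->] : #|(~: I)%SET| = 1%N by lia.
  rewrite subset_sum1 -(scalarfN (simplex_coord_scalar i)).
  apply: le_trans (g_le _ _) _.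
  have -> : N (- x) = N x by rewrite -scaleN1r rvnZ normrN1 mul1r.
  by [].
pose phi i x := c^-1 * g i x.
pose b i : normed_rV N := permute (tperm ord0 i) a.
apply: (@star_vertex_degree _ _ _ b phi) => [i u x y|I x|i|i].
- by rewrite /phi simplex_coord_scalar /=; ring.
- rewrite -mulr_sumr -/(subset_sum I x) mulrC ler_pdivrMr// mulrC normed_rVE.
  exact: sum_le.
- by rewrite /phi /b permuteE tpermR -/c mulVf// lt0r_neq0.
- by rewrite normed_rVE permute_norm -normed_rVE.
Qed.

End Exponent.

Lemma exists_smooth_vmax :
  exists X : completeNormedModType R, [/\ has_dim d X, smooth X & is_v X d.+1].
Proof.
have [m m0 m_large] := exists_exponent.
have dimX := has_dim_normed_rV (simplex_norm m0).
have smX : smooth (normed_rV (simplex_norm m0) : completeNormedModType R).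
  exact: smooth_power_norm.
exists (normed_rV (simplex_norm m0)); split=> //; split.
  exact: simplex_vertex_degree.
by move=> n; exact: vertex_degree_le.
Qed.

End SimplexNorm.

Theorem theorem3 (R : realType) (d : nat) (hd : (2 <= d)%N) :
  [/\ forall X : completeNormedModType R, has_dim d X -> smooth X ->
        exists s v : nat,
          [/\ is_s X s, is_v X v, (3 <= s)%N, (s <= v)%N & (v <= d.+1)%N],
      exists X : completeNormedModType R,
        [/\ has_dim d X, smooth X & is_s X 3]
    & exists X : completeNormedModType R,
        [/\ has_dim d X, smooth X & is_v X d.+1]].
Proof.
split; last exact: exists_smooth_vmax; last exact: exists_smooth_s3.
by move=> X; exact: smooth_steiner_degrees.
Qed.
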